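(* Let $h\in G_d$ with $d>1$, let $g(x)=h^{-1}(1/x)$ and $f(x)=1/h(1/x)$, and let $\Omega\subset\mathbb R^2$ be defined by $$\Omega=\{(x,y)\in\mathbb R^2:\ x\ge1,\ |y|\le g(x)\}.$$ Then the eigenvalue counting function $N(\lambda,\Omega)$ of the Dirichlet problem $-\Delta u=\lambda u$ in $\Omega$, $u=0$ on $\partial\Omega$, satisfies, as $\lambda\to\infty$, $$N(\lambda,\Omega)\ge\frac{1}{d-1}\,\frac{\lambda^{1/2}}{\pi}f\Big(\frac{\lambda^{1/2}}{2\pi}\Big)+o\Big(\lambda^{1/2}f\Big(\frac{\lambda^{1/2}}{2\pi}\Big)\Big).$$
   Context: For $d>1$, $G_d$ is the class of continuous functions $h:(0,\infty)\to(0,\infty)$ such that: (i) $h$ is strictly increasing, $\lim_{x\to0^+}h(x)=0$ and $\lim_{x\to\infty}h(x)=\infty$; (ii) for every $t>0$, $\lim_{x\to0^+}h(tx)/h(x)=t^d$, uniformly for $t$ in compact subsets of $(0,\infty)$; (iii) $\lim_{x\to0^+}h(x)/x=0$. The eigenvalue problem is understood for the Dirichlet Laplacian (form domain $H_0^1$ of the interior of $\Omega$). Since $g(x)\searrow0$ as $x\to\infty$, the domain is quasibounded and the spectrum is discrete: a sequence $0<\lambda_1<\lambda_2\le\cdots\nearrow\infty$, eigenvalues being repeated according to multiplicity. $N(\lambda,\Omega)=\#\{n\in\mathbb N:\lambda_n\le\lambda\}$. *)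

(* Defs.v *)
From HB Require Import structures.
From mathcomp Require Import all_boot all_order all_algebra.
From mathcomp Require Import all_classical all_reals all_analysis.

Set Implicit Arguments.
Unset Strict Implicit.
Unset Printing Implicit Defensive.

Import Order.TTheory GRing.Theory Num.Theory.
Import numFieldNormedType.Exports.

Local Open Scope classical_set_scope.
Local Open Scope ring_scope.

(* [h : (0,oo) -> (0,oo)] is a total function of which only the restriction to
   the open half-line matters. *)

Definition classG (R : realType) (d : R) (h : R -> R) : Prop :=
  [/\ [/\ (forall x, 0 < x -> 0 < h x),
          (forall x, 0 < x -> {for x, continuous h}),
          (forall x y, 0 < x -> x < y -> h x < h y),
          h x @[x --> 0^'+] --> 0
        & h x @[x --> +oo] --> +oo],
      [/\ (forall t, 0 < t -> h (t * x) / h x @[x --> 0^'+] --> t `^ d)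
        & (forall K : set R, compact K -> K `<=` [set t | 0 < t] ->
            {uniform K, (fun x t => h (t * x) / h x) @ 0^'+ -->
                        (fun t => t `^ d)})]
    & h x / x @[x --> 0^'+] --> 0].

(* g(x) = h^{-1}(1/x), the inverse being that of [h] on the open half-line *)
Definition hornG (R : realType) (h : R -> R) (x : R) : R :=
  pinv [set t : R | 0 < t] h x^-1.

Definition hornF (R : realType) (h : R -> R) (x : R) : R := (h x^-1)^-1.

Definition horn (R : realType) (h : R -> R) : set (R * R) :=
  [set z | 1 <= z.1 /\ `|z.2| <= hornG h z.1].

(* Functions on an open set [U] of the plane are identified with their
   extensions by zero, so all norms and integrals below are over the plane. *)
Local Notation plane_measure R :=
  (@lebesgue_measure R \x @lebesgue_measure R)%E.

Definition partialx (R : realType) (phi : R * R -> R) : R * R -> R :=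
  fun z => 'D_((1, 0) : R * R) phi z.

Definition partialy (R : realType) (phi : R * R -> R) : R * R -> R :=
  fun z => 'D_((0, 1) : R * R) phi z.

Fixpoint classC (R : realType) (k : nat) (phi : R * R -> R) : Prop :=
  if k is k'.+1 then
    [/\ continuous phi,
        (forall z, derivable phi z (1, 0) /\ derivable phi z (0, 1)),
        classC k' (partialx phi) & classC k' (partialy phi)]
  else continuous phi.

(* C_c^oo(U) *)
Definition test_function (R : realType) (U : set (R * R)) (phi : R * R -> R) :
    Prop :=
  [/\ (forall k, classC k phi),
      compact (closure [set z | phi z != 0])
    & closure [set z | phi z != 0] `<=` U].

Definition L2 (R : realType) : {pred (R * R -> R)} :=
  Lfun (plane_measure R) 2%:E.

Definition L2_cvg (R : realType) (u_ : nat -> R * R -> R) (u : R * R -> R) :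
    Prop :=
  'N[plane_measure R]_2%:E[EFin \o (u_ n \- u)%R]%E @[n --> \oo] --> 0%E.

Definition L2_dot (R : realType) (u v : R * R -> R) : R :=
  \int[plane_measure R]_z (u z * v z).

(* [H10 U u p q]: [u] is in H_0^1(U), the closure of C_c^oo(U) in the H^1 norm,
   and [(p, q)] is its weak gradient; the latter is determined by [u] up to a
   null set, as the L^2 limit of the gradients of the approximating functions
   satisfies the integration by parts formula. *)
Definition H10 (R : realType) (U : set (R * R)) (u p q : R * R -> R) : Prop :=
  [/\ u \in @L2 R, p \in @L2 R, q \in @L2 R
    & exists phi : nat -> R * R -> R,
      [/\ (forall n, test_function U (phi n)),
          L2_cvg phi u,
          L2_cvg (fun n => partialx (phi n)) p
        & L2_cvg (fun n => partialy (phi n)) q]].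

(* [u] is in the domain of the operator associated with the form
   [\int grad u . grad v] on H_0^1(U), and [- Delta u = mu u]. The zero function
   is included, so this is the eigenspace of [mu], which is zero when [mu] is
   not an eigenvalue. *)
Definition dirichlet_eigenspace (R : realType) (U : set (R * R)) (mu : R) :
    set (R * R -> R) :=
  [set u | exists p q : R * R -> R,
    H10 U u p q /\
    forall v r s, H10 U v r s ->
      L2_dot p r + L2_dot q s = mu * L2_dot u v].

(* linear independence as elements of L^2, i.e. modulo null sets *)
Definition ae_free (R : realType) (n : nat) (u : 'I_n -> R * R -> R) : Prop :=
  forall c : 'I_n -> R,
    {ae plane_measure R, forall z, \sum_(i < n) c i * u i z = 0} ->
    forall i, c i = 0.

(* Dimension of the eigenspace, [+oo] if infinite; it is the largest size of a
   free family because subfamilies of free families are free. *)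
Definition multiplicity (R : realType) (U : set (R * R)) (mu : R) : \bar R :=
  ereal_sup [set n%:R%:E | n in [set n : nat |
    exists2 u : 'I_n -> R * R -> R,
      (forall i, dirichlet_eigenspace U mu (u i)) & ae_free u]].

(* The number of eigenvalues in ]-oo, lambda], repeated according to
   multiplicity. By [dirichlet_countE] it is #{n : lam n <= lambda} for every
   enumeration [lam] of the eigenvalues with multiplicity; defining it by the sum
   makes it meaningful without first proving that the spectrum is discrete. *)
Definition dirichlet_count (R : realType) (U : set (R * R)) (lambda : R) :
    \bar R :=
  \esum_(mu in [set mu | mu <= lambda]) multiplicity U mu.

Definition eigenvalue_sequence (R : realType) (U : set (R * R))
    (lam : nat -> R) : Prop :=
  {homo lam : m n / (m <= n)%N >-> m <= n} /\
  forall mu, multiplicity U mu = \esum_(n in [set n | lam n = mu]) 1%:E.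

Lemma dirichlet_countE (R : realType) (U : set (R * R)) (lam : nat -> R)
    (lambda : R) : eigenvalue_sequence U lam ->
  dirichlet_count U lambda = \esum_(n in [set n | lam n <= lambda]) 1%:E.
Proof.
move=> [_ lamE]; rewrite /dirichlet_count.
under eq_esum do rewrite lamE.
rewrite esum_esum; last by move=> *; exact: lee01.
rewrite (reindex_esum [set n | lam n <= lambda] _ (fun n => (lam n, n))) //.
split=> //=.
- by move=> m n _ _ [].
- by move=> [mu n] /= [le_mu lam_n]; exists n; rewrite /= ?lam_n.
Qed.

(* Main.v *)
Require Import Defs.
From HB Require Import structures.
From mathcomp Require Import all_boot all_order all_algebra.
From mathcomp Require Import all_classical all_reals all_analysis.
From mathcomp Require Import measurable_realfun ring lra.

Set Implicit Arguments.
Unset Strict Implicit.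
Unset Printing Implicit Defensive.

Import Order.TTheory GRing.Theory Num.Theory.
Import numFieldNormedType.Exports.

Local Open Scope classical_set_scope.
Local Open Scope ring_scope.

(* Put s = 2 pi / sqrt lambda. A smooth bump supported in a square of side s has
   Rayleigh quotient at most 36 / s^2 = 9 lambda / pi^2 <= lambda, so by the
   min-max principle the number of disjoint squares of side s inside the horn is
   a lower bound for N(lambda). A column of width s ending at abscissa x holds k
   stacked squares as soon as g(x) >= k s / 2, that is x <= 1 / h(k s / 2), so
   there are about (1/s) sum_k 1 / h(k s / 2) squares. By regular variation of h
   at 0 this is (1 / (s h(s))) sum_k (k / 2)^(-d), and as 2^d zeta(d) > 2 / (d - 1)
   a finite number of values of k already beats the main term, which equals
   (2 / (d - 1)) / (s h(s)). The remainder can therefore be taken to be 0.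

   The min-max principle requires H^1_0 to embed compactly in L^2: on a bounded
   part of the horn this is the Poincare inequality (for functions minus their
   mean) on the cells of a fine grid, and far out the horn is thin, so there the
   Poincare inequality in the vertical direction makes the mass small. *)

(** * Min-max principle for a pair of quadratic forms *)

(** [dirichlet_count] adds up multiplicities of eigenspaces, so a lower bound requires genuine
    eigenfunctions: [n] trial functions have to be turned into [n] orthonormal eigenvectors with
    eigenvalue at most lambda. They are produced one at a time by constrained minimisation, in an
    abstract setting with two semidefinite forms. Semidefiniteness is imposed by the function space:
    elements of [Lfun] are functions and not classes modulo null sets, so a nonzero element may have
    mass 0.

    The constants rest on a factor 2 of slack. The least Rayleigh quotient on a square of side s is
    2 pi^2 / s^2, whereas lambda = 4 pi^2 / s^2. This leaves room for an explicit bump with constant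
    16 instead of pi^2 in each variable, for a support strictly inside the cell, and for the crude
    estimate pi >= 3. Likewise zeta(d) >= 1 / (d - 1) and 2^d > 2 leave a strict margin in the sum
    over k, which absorbs all rounding losses. *)

Definition psd_form (R : realType) (V : lmodType R) (f : V -> V -> R) : Prop :=
  [/\ forall c u v w, f (c *: u + v) w = c * f u w + f v w,
      forall u v, f u v = f v u & forall u, 0 <= f u u].

Section PsdForm.
Context (R : realType) (V : lmodType R) (f : V -> V -> R).
Hypothesis ff : psd_form f.

Lemma psdC u v : f u v = f v u. Proof. by case: ff. Qed.

Lemma psd_ge0 u : 0 <= f u u. Proof. by case: ff. Qed.

Lemma psd_linl c u v w : f (c *: u + v) w = c * f u w + f v w.
Proof. by case: ff. Qed.

Lemma psdDl u v w : f (u + v) w = f u w + f v w.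
Proof. by rewrite -[u]scale1r psd_linl mul1r scale1r. Qed.

Lemma psd0l w : f 0 w = 0.
Proof. by apply: (addrI (f 0 w)); rewrite -psdDl !addr0. Qed.

Lemma psdZl c u w : f (c *: u) w = c * f u w.
Proof. by rewrite -[c *: u]addr0 psd_linl psd0l addr0. Qed.

Lemma psdDr u v w : f w (u + v) = f w u + f w v.
Proof. by rewrite psdC psdDl !(psdC w). Qed.

Lemma psdZr c u w : f w (c *: u) = c * f w u.
Proof. by rewrite psdC psdZl (psdC w). Qed.

Lemma psd0r w : f w 0 = 0.
Proof. by rewrite psdC psd0l. Qed.

Lemma psdNl u w : f (- u) w = - f u w.
Proof. by rewrite -scaleN1r psdZl mulN1r. Qed.

Lemma psdNr u w : f w (- u) = - f w u.
Proof. by rewrite psdC psdNl psdC. Qed.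

Definition psdE := (psdDl, psdDr, psdNl, psdNr, psdZl, psdZr, psd0l, psd0r).

Lemma psd_suml (I : Type) (r : seq I) (P : pred I) (u : I -> V) w :
  f (\sum_(i <- r | P i) u i) w = \sum_(i <- r | P i) f (u i) w.
Proof.
by elim/big_rec2: _ => [|i x y _ <-]; rewrite ?psd0l ?psdDl.
Qed.

Lemma psd_sumr (I : Type) (r : seq I) (P : pred I) (u : I -> V) w :
  f w (\sum_(i <- r | P i) u i) = \sum_(i <- r | P i) f w (u i).
Proof. by rewrite psdC psd_suml; apply: eq_bigr => i _; exact: psdC. Qed.

Lemma psd_orthogonal_sum (n : nat) (c : 'I_n -> R) (v : 'I_n -> V) :
  (forall i j, i != j -> f (v i) (v j) = 0) ->
  let w := \sum_(i < n) c i *: v i in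
  f w w = \sum_(i < n) c i ^+ 2 * f (v i) (v i).
Proof.
move=> v0 /=; rewrite psd_suml; apply: eq_bigr => i _.
rewrite psdZl psd_sumr (bigD1 i)//= big1 => [|j ji].
  by rewrite psdZr addr0 mulrA expr2.
by rewrite psdZr v0 ?mulr0// eq_sym.
Qed.

Lemma psd_CS u v : f u v ^+ 2 <= f u u * f v v.
Proof.
have key t : 0 <= f u u + t * f u v *+ 2 + t ^+ 2 * f v v.
  have := psd_ge0 (u + t *: v); rewrite !psdE (psdC v u).
  by move=> /le_trans; apply; rewrite le_eqVlt; apply/orP; left; apply/eqP; ring.
have := psd_ge0 v; rewrite le_eqVlt => /predU1P[v0|v0].
  rewrite -v0 mulr0; have [->|nz] := eqVneq (f u v) 0; first by rewrite expr0n.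
  (* When [f v v = 0] the polynomial in [t] is affine; this [t] would give it the value -1.
     Otherwise the test value below is its minimiser. *)
  have := key (- (f u u + 1) / f u v / 2); rewrite -v0 mulr0 addr0.
  have -> : f u u + (- (f u u + 1) / f u v / 2) * f u v *+ 2 = -1 by field.
  by rewrite oppr_ge0 ler10.
have := key (- f u v / f v v).
have -> : f u u + - f u v / f v v * f u v *+ 2 + (- f u v / f v v) ^+ 2 * f v v =
    f u u - f u v ^+ 2 / f v v by field; rewrite gt_eqF.
by rewrite subr_ge0 ler_pdivrMr.
Qed.

Section Limit.
Context (w_ : nat -> V) (w : V).
Hypothesis w_cvg : f (w_ n - w) (w_ n - w) @[n --> \oo] --> 0.

Lemma psd_cvgl v : f (w_ n) v @[n --> \oo] --> f w v.
Proof.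
apply/cvgrPdist_le => /= eps eps0.
have e2 : 0 < eps ^+ 2 / (f v v + 1).
  by rewrite divr_gt0 ?exprn_gt0// ltr_wpDl// psd_ge0.
move/cvgrPdist_le : w_cvg => /(_ _ e2); apply: filterS => n /=.
rewrite sub0r normrN ger0_norm ?psd_ge0// => dn.
rewrite distrC -psdNl -psdDl -(@ler_pXn2r _ 2)// ?nnegrE// ?(ltW eps0)//.
rewrite real_normK ?num_real//. rewrite (le_trans (psd_CS _ _))//.
rewrite (le_trans (ler_wpM2r (psd_ge0 _) dn))//.
rewrite mulrAC ler_pdivrMr ?ltr_wpDl ?psd_ge0//.
by rewrite ler_wpM2l ?sqr_ge0// lerDl.
Qed.

Lemma psd_cvg : f (w_ n) (w_ n) @[n --> \oo] --> f w w.
Proof.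
have -> : (fun n => f (w_ n) (w_ n)) = (fun n =>
    f (w_ n - w) (w_ n - w) + (f (w_ n) w + f (w_ n) w - f w w)).
  apply/funext => n; rewrite !psdE (psdC w (w_ n)); ring.
rewrite -[X in _ --> X]add0r; apply: cvgD => //.
rewrite -[X in _ --> X](addrK (f w w)).
by apply: cvgB; [apply: cvgD; exact: psd_cvgl|exact: cvg_cst].
Qed.
End Limit.
End PsdForm.

(** Vanishing of the first variation at a minimum. The test value uses [y + 1] rather than [y] as
    denominator so as to include [y = 0]. *)
Lemma quad_lin_eq0 (R : realType) (x y : R) :
  (forall t, 0 <= t * x *+ 2 + t ^+ 2 * y) -> 0 <= y -> x = 0.
Proof.
move=> h y0; have y1 : 0 < y + 1 by rewrite ltr_wpDl.
apply/eqP; rewrite -sqrf_eq0 eq_le sqr_ge0 andbT.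
have := h (- x / (y + 1)).
have -> : - x / (y + 1) * x *+ 2 + (- x / (y + 1)) ^+ 2 * y =
    - (x ^+ 2 * (y + 2)) / (y + 1) ^+ 2 by field; rewrite gt_eqF.
rewrite pmulr_lge0 ?invr_gt0 ?exprn_gt0// oppr_ge0 pmulr_lle0//.
by rewrite ltr_wpDl.
Qed.

Section Spectral.
Context (R : realType) (V : lmodType R) (a b : V -> V -> R).
Hypothesis (fa : psd_form a) (fb : psd_form b).

Definition form_complete := forall w_ : nat -> V,
  (forall eps, 0 < eps -> exists N, forall m n, (N <= m)%N -> (N <= n)%N ->
     a (w_ m - w_ n) (w_ m - w_ n) + b (w_ m - w_ n) (w_ m - w_ n) <= eps) ->
  exists w, a (w_ n - w) (w_ n - w) @[n --> \oo] --> 0 /\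
            b (w_ n - w) (w_ n - w) @[n --> \oo] --> 0.

(* Finitely many [b]-bounded functionals control [b] up to an arbitrarily small
   multiple of [a]: total boundedness in [b] of the sets bounded in [a + b]. *)
Definition form_compact := forall eps, 0 < eps ->
  exists (N : nat) (l : 'I_N -> V -> R) (C : R),
  [/\ forall i u v, l i (u - v) = l i u - l i v,
      forall i u, l i u ^+ 2 <= C * b u u
    & forall u, b u u <= eps * a u u + \sum_(i < N) l i u ^+ 2].

Hypotheses (cplt : form_complete) (cpct : form_compact).

(** Ultrafilters replace extraction of subsequences: a single [G] makes all functionals converge,
    for every precision at once. *)
Lemma bounded_ultra_cvg (G : set_system nat) (x : nat -> R) (C : R) :
  UltraFilter G -> (forall n, `|x n| <= C) -> exists l : R, x @ G --> l.
Proof.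
move=> GU xC; have GP : ProperFilter G by exact: ultra_proper.
have [|l [_ cl]] := @segment_compact R (- C) C (x @ G) _.
  by rewrite /fmap /=; apply: filterE => n /=; rewrite in_itv/= -ler_norml.
exists l => A Al; have [//|GA] := in_ultra_setVsetC (x @^-1` A) GU.
have [y [/= nA Ay]] := cl (~` A) A GA Al.
by case: nA.
Qed.

(** Along an ultrafilter finer than [\oo] every functional of [form_compact] converges on the
    sequence, so on a set of the ultrafilter its values are pairwise close, and the compactness
    inequality makes [b] of the differences small. *)
Lemma form_cauchy_subseq (w_ : nat -> V) (C : R) :
  (forall n, b (w_ n) (w_ n) <= 1) -> (forall n, a (w_ n) (w_ n) <= C) ->
  exists phi : nat -> nat, (forall n, (n <= phi n)%N) /\
    forall eps, 0 < eps -> exists N, forall m n, (N <= m)%N -> (N <= n)%N ->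
      b (w_ (phi m) - w_ (phi n)) (w_ (phi m) - w_ (phi n)) <= eps.
Proof.
move=> w1 wC.
have C0 : 0 <= C := le_trans (psd_ge0 fa _) (wC 0%N).
have [G [GU sFG]] := @ultraFilterLemma _ (\oo) _.
have small eps : 0 < eps -> exists A, G A /\ forall m n, A m -> A n ->
    b (w_ m - w_ n) (w_ m - w_ n) <= eps.
  move=> eps0; have C1 : 0 < C + 1 by rewrite ltr_wpDl.
  (* By the parallelogram law [a] of a difference is at most [4 * C], so this weight leaves at most
     [eps / 2] for the energy term. *)
  have e0 : 0 < eps / (8 * (C + 1)) by rewrite divr_gt0// mulr_gt0.
  have [N [l [K [lB lK bl]]]] := cpct e0.
  have K0 : 0 <= `|K| + 1 by rewrite addr_ge0.
  have lb i n : `|l i (w_ n)| <= `|K| + 1.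
    rewrite -(@ler_pXn2r _ 2)// ?nnegrE// real_normK ?num_real//.
    rewrite (le_trans (lK _ _))// (@le_trans _ _ `|K|)//.
      rewrite (le_trans (ler_norm _))// normrM ler_piMr//.
      by rewrite ger0_norm ?psd_ge0.
    have := normr_ge0 K; nra.
  have cv i := bounded_ultra_cvg GU (lb i).
  (* The share of each functional in the other half of [eps]; [N.+1] keeps it defined when
     [N = 0]. *)
  pose d := eps / (2 * N.+1%:R) : R.
  have d0 : 0 < d by rewrite divr_gt0// mulr_gt0.
  have [d' d'0 d'd] : exists2 d', 0 < d' & forall x : R, `|x| <= d' *+ 2 -> x ^+ 2 <= d.
    exists (Num.sqrt d / 2); first by rewrite divr_gt0// sqrtr_gt0.
    move=> x; have -> : Num.sqrt d / 2 *+ 2 = Num.sqrt d by field.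
    by rewrite -(@ler_pXn2r _ 2)// ?nnegrE ?sqrtr_ge0// sqr_sqrtr ?(ltW d0)//
      real_normK ?num_real.
  have [L Lcv] := choice cv.
  pose A := [set n | forall i, `|L i - l i (w_ n)| <= d'].
  exists A; split.
    apply: filter_forall => i.
    by move/cvgrPdist_le : (Lcv i) => /(_ _ d'0).
  move=> m n Am An; rewrite (le_trans (bl _))//.
  rewrite [leRHS](splitr eps).
  apply: lerD.
    have : a (w_ m - w_ n) (w_ m - w_ n) <= 4 * C.
      have := psd_ge0 fa (w_ m + w_ n); have := wC m; have := wC n.
      rewrite !(psdE fa) (psdC fa (w_ n)); lra.
    move=> aC; rewrite (le_trans (ler_wpM2l (ltW e0) aC))//.
    rewrite -subr_ge0.
    have -> : eps / 2 - eps / (8 * (C + 1)) * (4 * C) = eps / 2 / (C + 1).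
      by field; rewrite gt_eqF.
    by rewrite !divr_ge0// ltW.
  apply: (@le_trans _ _ (\sum_(i < N) d)).
    apply: ler_sum => i _; apply: d'd; rewrite lB.
    have := Am i; have := An i.
    rewrite !ler_norml => /andP[? ?] /andP[? ?]; apply/andP; split; lra.
  rewrite sumr_const card_ord -[d *+ N]mulr_natr.
  have -> : d * N%:R = eps / 2 * (N%:R / N.+1%:R) by rewrite /d; field.
  by rewrite ler_piMr ?divr_ge0 ?(ltW eps0)// ler_pdivrMr// mul1r ler_nat.
have /choice[A HA] : forall k : nat, exists A, G A /\ forall m n, A m -> A n ->
    b (w_ m - w_ n) (w_ m - w_ n) <= k.+1%:R^-1.
  by move=> k; exact: small.
(* A diagonal choice: [phi k] lies in the sets of the first [k + 1] precisions. It need not be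
   increasing, but it dominates [k]. *)
have /choice[phi Hphi] : forall k : nat, exists n, (k <= n)%N /\
    forall i, (i <= k)%N -> A i n.
  move=> k; apply: (@filter_ex _ G).
  apply: filterI; first by apply: sFG; exact: nbhs_infty_ge.
  have : G [set n | forall i : 'I_k.+1, A i n].
    by apply: filter_forall => i; exact: (HA i).1.
  by apply: filterS => n /= An i ik; have /= := An (Ordinal (ik : (i < k.+1)%N)).
exists phi; split=> [n|eps eps0]; first exact: (Hphi n).1.
have [N HN] : exists N : nat, N.+1%:R^-1 < eps.
  near \oo => N; exists N.
  by near: N; exact: (near_infty_natSinv_lt (PosNum eps0)).
exists N => m n Nm Nn; rewrite (le_trans _ (ltW HN))//.
by apply: (HA N).2; apply: (Hphi _).2.
Unshelve. all: by end_near. Qed.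

(** Direct method: [mu] is the infimum of the Rayleigh quotient on [W], and a minimising sequence
    that is Cauchy for [b] is also Cauchy for [a]. The last clause is the Euler-Lagrange equation,
    tested on [W] only. *)
Lemma constrained_minimizer (W : set V) (v : V) (lambda : R) :
  (forall c u w, W u -> W w -> W (c *: u + w)) ->
  (forall (w_ : nat -> V) w, (forall n, W (w_ n)) ->
     b (w_ n - w) (w_ n - w) @[n --> \oo] --> 0 -> W w) ->
  W v -> 0 < b v v -> a v v <= lambda * b v v ->
  exists e mu, [/\ W e, b e e = 1, mu <= lambda &
    forall w, W w -> a e w = mu * b e w].
Proof.
move=> Wlin Wcl Wv bv avlam.
have W0 : W 0 by have := Wlin (- 1) v v Wv Wv; rewrite scaleN1r addNr.
have WZ c w : W w -> W (c *: w).
  by move=> Ww; have := Wlin c w 0 Ww W0; rewrite addr0.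
have normalize w : W w -> 0 < b w w ->
    exists c, [/\ W (c *: w), b (c *: w) (c *: w) = 1 &
      a (c *: w) (c *: w) = a w w / b w w].
  move=> Ww bw; exists (Num.sqrt (b w w))^-1; split; first exact: WZ.
    rewrite !(psdE fb) mulrA -invfM -expr2 sqr_sqrtr ?(ltW bw)//.
    by rewrite mulVf// gt_eqF.
  by rewrite !(psdE fa) mulrA -invfM -expr2 sqr_sqrtr ?(ltW bw)// mulrC.
pose S := [set a w w | w in [set w | W w /\ b w w = 1]].
have S0 : has_inf S.
  split; first by have [c [? ? _]] := normalize _ Wv bv; exists (a (c *: v) (c *: v)), (c *: v).
  by exists 0 => _ [w _ <-]; exact: psd_ge0.
pose mu := inf S.
have mu_le w : W w -> mu * b w w <= a w w.
  move=> Ww; have := psd_ge0 fb w; rewrite le_eqVlt => /predU1P[<-|bw].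
    by rewrite mulr0 psd_ge0.
  have [c [Wc bc ac]] := normalize _ Ww bw.
  rewrite -ler_pdivlMr// -ac; apply: ge_inf; first by case: S0.
  by exists (c *: w).
have mulam : mu <= lambda.
  by rewrite -(ler_pM2r bv) (le_trans (mu_le _ Wv)).
have mu0 : 0 <= mu by apply: lb_le_inf; [case: S0|move=> _ [w _ <-]; exact: psd_ge0].
have /choice[w_ Hw] : forall n : nat, exists w, [/\ W w, b w w = 1 &
    a w w < mu + n.+1%:R^-1].
  move=> n; have n0 : 0 < n.+1%:R^-1 :> R by rewrite invr_gt0.
  by have [_ [w [Ww bw] <-] aw] := inf_adherent n0 S0; exists w.
have Ww n : W (w_ n) by case: (Hw n).
have bw n : b (w_ n) (w_ n) = 1 by case: (Hw n).
have aw n : a (w_ n) (w_ n) < mu + n.+1%:R^-1 by case: (Hw n).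
have aw1 n : a (w_ n) (w_ n) <= mu + 1.
  by rewrite (le_trans (ltW (aw n)))// lerD2l invf_le1// ler1n.
have [|phi [phin phic]] := form_cauchy_subseq _ aw1; first by move=> n; rewrite bw.
have awphi : a (w_ (phi n)) (w_ (phi n)) @[n --> \oo] --> mu.
  apply: (@squeeze_cvgr _ _ _ _ (fun=> mu) (fun n => mu + n.+1%:R^-1)).
  - near=> n; apply/andP; split.
      by have := mu_le _ (Ww (phi n)); rewrite bw mulr1.
    rewrite (le_trans (ltW (aw _)))// lerD2l lef_pV2 ?posrE// ler_nat.
    by rewrite ltnS.
  - exact: cvg_cst.
  - rewrite -[X in _ --> X]addr0; apply: cvgD; first exact: cvg_cst.
    exact: cvg_harmonic.
have [|e [ea eb]] := cplt (w_ := w_ \o phi).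
  move=> eps eps0; have e4 : 0 < eps / 8 by rewrite divr_gt0.
  have em : 0 < eps / (2 * (mu + 1)) by rewrite divr_gt0// mulr_gt0// ltr_wpDl.
  have [N1 HN1] := phic _ em.
  move/cvgrPdist_le : awphi => /(_ _ e4)[N2 _ HN2].
  exists (maxn N1 N2) => m n; rewrite !geq_max => /andP[m1 m2] /andP[n1 n2] /=.
  have := HN1 _ _ m1 n1; have := HN2 _ m2; have := HN2 _ n2 => /=.
  have Wmn : W (w_ (phi m) + w_ (phi n)).
    by have := Wlin 1 _ _ (Ww (phi m)) (Ww (phi n)); rewrite scale1r.
  have := mu_le _ Wmn; have := bw (phi m); have := bw (phi n).
  set wm := w_ (phi m); set wn := w_ (phi n) => bn bm.
  rewrite !ler_norml => sum /andP[an _] /andP[am _] bmn.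
  (* Parallelogram law for both forms: [wm + wn] is in [W], hence its energy is at least [mu * b],
     while [wm] and [wn] have energy at most [mu + eps / 8]. *)
  have amn : a (wm - wn) (wm - wn) <= eps / 2 + mu * b (wm - wn) (wm - wn).
    move: sum; rewrite !(psdE fa) !(psdE fb) (psdC fa wn wm) (psdC fb wn wm) bn bm.
    lra.
  have : (mu + 1) * b (wm - wn) (wm - wn) <= eps / 2.
    rewrite mulrC -ler_pdivlMr ?ltr_wpDl// (le_trans bmn)//.
    by rewrite le_eqVlt; apply/orP; left; apply/eqP; field; rewrite gt_eqF// ltr_wpDl.
  lra.
have be : b e e = 1.
  have := psd_cvg fb eb; have -> : (fun n => b (w_ (phi n)) (w_ (phi n))) = fun=> 1.
    by apply/funext => n.
  by move=> /cvg_lim <- //; rewrite lim_cst.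
have ae : a e e = mu.
  by have /cvg_lim <- // := psd_cvg fa ea; apply/cvg_lim.
have We : W e by apply: Wcl eb => n; exact: Ww.
exists e, mu; split=> // w Ww'.
apply/eqP; rewrite -subr_eq0; apply/eqP.
apply: (@quad_lin_eq0 _ _ (a w w - mu * b w w)); last by rewrite subr_ge0 mu_le.
move=> t; have := mu_le _ (Wlin t _ _ Ww' We).
rewrite !(psdE fa) !(psdE fb) ae be (psdC fa w e) (psdC fb w e) -subr_ge0.
by move=> /le_trans; apply; rewrite le_eqVlt; apply/orP; left; apply/eqP; ring.
Unshelve. all: by end_near. Qed.

(** Induction on the number of eigenvectors found. The trial space has dimension [n > k], so it
    contains a nonzero vector [b]-orthogonal to the first [k] of them; it shows that the constrained
    minimum does not exceed [lambda]. *)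
Lemma minmax_eigenvectors (n : nat) (v : 'I_n -> V) (lambda : R) :
  (forall c : 'I_n -> R, let w := \sum_(i < n) c i *: v i in
     a w w <= lambda * b w w) ->
  (forall c : 'I_n -> R, let w := \sum_(i < n) c i *: v i in
     b w w = 0 -> forall i, c i = 0) ->
  exists (e : nat -> V) (mu : nat -> R),
    [/\ forall i j, (i < n)%N -> (j < n)%N -> b (e i) (e j) = (i == j)%:R,
        forall i, (i < n)%N -> mu i <= lambda
      & forall i w, (i < n)%N -> a (e i) w = mu i * b (e i) w].
Proof.
move=> vlam vfree.
suff main k : (k <= n)%N -> exists (e : nat -> V) (mu : nat -> R),
    [/\ forall i j, (i < k)%N -> (j < k)%N -> b (e i) (e j) = (i == j)%:R,
        forall i, (i < k)%N -> mu i <= lambda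
      & forall i w, (i < k)%N -> a (e i) w = mu i * b (e i) w].
  exact: main.
elim: k => [_|k IH kn]; first by exists (fun=> 0), (fun=> 0).
have [e [mu [eo mule eeig]]] := IH (ltnW kn).
pose W := [set w | forall i, (i < k)%N -> b w (e i) = 0].
have [c cN0 Wc] : exists2 c : 'I_n -> R, ~ (forall i, c i = 0) &
    W (\sum_(i < n) c i *: v i).
  (* An [n] by [k] matrix with [k < n] has a nonzero left kernel; a kernel row gives the
     coefficients. *)
  pose M := \matrix_(i < n, j < k) b (v i) (e j).
  have : kermx M != 0.
    by rewrite kermx_eq0 /row_free neq_ltn (leq_ltn_trans (rank_leq_col M)).
  move=> /rowV0Pn[r rM r0]; exists (fun i => r 0 i).
    move=> r00; move/eqP : r0; apply; apply/rowP => i.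
    by rewrite r00 mxE.
  move=> j jk; have /sub_kermxP/rowP/(_ (Ordinal jk)) := rM.
  rewrite !mxE => <-; rewrite (psd_suml fb); apply: eq_bigr => i _.
  by rewrite !(psdE fb) mxE.
have bw0 : 0 < b (\sum_(i < n) c i *: v i) (\sum_(i < n) c i *: v i).
  rewrite lt_neqAle psd_ge0// andbT; apply/eqP => /esym /vfree.
  exact: cN0.
have [||e1 [mu1 [We1 be1 mu1le e1eig]]] :=
  @constrained_minimizer W _ lambda _ _ Wc bw0 (vlam c).
- move=> t u w Wu Ww i ik; rewrite !(psdE fb) Wu// Ww// mulr0 addr0//.
- move=> w_ w Ww_ bw i ik.
  have /cvg_lim <- // := psd_cvgl fb bw (v := e i).
  have -> : (fun n => b (w_ n) (e i)) = fun=> 0.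
    by apply/funext => m; exact: Ww_.
  exact: lim_cst.
exists (fun i => if i == k then e1 else e i),
  (fun i => if i == k then mu1 else mu i); split.
- move=> i j; rewrite !ltnS leq_eqVlt => /predU1P[->|ik].
    rewrite eqxx leq_eqVlt => /predU1P[->|jk]; first by rewrite eqxx.
    by rewrite (ltn_eqF jk) (gtn_eqF jk) We1.
  rewrite (ltn_eqF ik) leq_eqVlt => /predU1P[->|jk].
    by rewrite eqxx (ltn_eqF ik) (psdC fb) We1.
  by rewrite (ltn_eqF jk) eo.
- by move=> i; rewrite ltnS leq_eqVlt => /predU1P[->|ik];
    rewrite ?eqxx// (ltn_eqF ik) mule.
- move=> i w; rewrite ltnS leq_eqVlt => /predU1P[->|ik]; last first.
    by rewrite (ltn_eqF ik) eeig.
  (* The equation is known on [W] only. The remaining part of [w] is a combination of the [e j], on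
     which both sides vanish: [b e1 (e j) = 0], and [a e1 (e j) = mu j * b e1 (e j)]. *)
  rewrite eqxx; pose w' := w - \sum_(j < k) b w (e j) *: e j.
  have Ww' : W w'.
    move=> j jk; rewrite /w' !(psdE fb) (psd_suml fb).
    rewrite (bigD1 (Ordinal jk))//= big1 => [|l lj].
      by rewrite !(psdE fb) eo// eqxx mulr1 addr0 subrr.
    rewrite !(psdE fb) eo//; have /negPf-> : (l : nat) != j by exact: lj.
    by rewrite mulr0.
  have wE : w = w' + \sum_(j < k) b w (e j) *: e j by rewrite /w' subrK.
  move: w' Ww' wE => w' Ww' ->.
  have bwe j : (j < k)%N -> b e1 (e j) = 0 by exact: We1.
  rewrite (psdDr fa) (psdDr fb) e1eig// (psd_sumr fa) (psd_sumr fb) !big1 ?addr0 ?mulr0//.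
  - by move=> j _; rewrite !(psdE fb) bwe// mulr0.
  - by move=> j _; rewrite !(psdE fa) (psdC fa) eeig// (psdC fb (e j)) bwe// !mulr0.
Qed.

End Spectral.

Lemma psd_add_le (R : realType) (W : lmodType R) (f : W -> W -> R) u v : psd_form f ->
  f (u + v) (u + v) <= 2 * f u u + 2 * f v v.
Proof.
move=> ff; have := psd_ge0 ff (u - v); rewrite !(psdE ff) (psdC ff v u); lra.
Qed.

Lemma eps_cvg0 (R : realType) (f : nat -> R) : (forall n, 0 <= f n <= n.+1%:R^-1) ->
  f n @[n --> \oo] --> 0.
Proof.
move=> f01; apply: (@squeeze_cvgr _ _ _ _ (fun=> 0) (fun n => n.+1%:R^-1)).
- by near=> n; exact: f01.
- exact: cvg_cst.
- exact: cvg_harmonic.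
Unshelve. all: by end_near. Qed.

(** * The closure of a space of test vectors in the norm given by two forms *)

Section FormClosure.
Context (R : realType) (V : lmodType R) (a b : V -> V -> R) (T : V -> Prop).
Implicit Types (fa : psd_form a) (fb : psd_form b) (Tz : T 0)
  (TL : forall c u v, T u -> T v -> T (c *: u + v)).

Definition form_limit (w : V) : Prop := forall eps, 0 < eps ->
  exists2 t, T t & a (t - w) (t - w) + b (t - w) (t - w) <= eps.

(* The proofs are arguments so that the canonical module structure of the
   closure can be inferred. *)
Definition form_closure fa fb Tz TL : {pred V} := [pred w | `[< form_limit w >]].

Lemma form_closure_submod fa fb Tz TL : submod_closed (form_closure fa fb Tz TL).
Proof.
split.
  rewrite inE => eps eps0; exists 0 => //.
  by rewrite subr0 (psd0l fa) (psd0l fb) addr0 ltW.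
move=> c u v; rewrite !inE => hu hv eps eps0.
have e1 : 0 < eps / 2 / (2 * (c ^+ 2 + 1)).
  by rewrite !divr_gt0// mulr_gt0// ltr_wpDl// sqr_ge0.
have e2 : 0 < eps / 4 by rewrite divr_gt0.
have [t tt tu] := hu _ e1; have [s ts sv] := hv _ e2.
exists (c *: t + s); first exact: TL.
have -> : c *: t + s - (c *: u + v) = c *: (t - u) + (s - v).
  by rewrite scalerBr opprD addrACA.
rewrite (le_trans (lerD (psd_add_le _ _ fa) (psd_add_le _ _ fb)))//.
rewrite !(psdZl fa) !(psdZl fb) !(psdZr fa) !(psdZr fb).
move: tu; rewrite ler_pdivlMr ?mulr_gt0 ?ltr_wpDl ?sqr_ge0//.
have := psd_ge0 fa (t - u); have := psd_ge0 fb (t - u).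
move: (a (t - u) _) (b (t - u) _) (a (s - v) _) (b (s - v) _) sv => x y x' y'.
nra.
Qed.

HB.instance Definition _ fa fb Tz TL := GRing.isSubmodClosed.Build _ _
  (form_closure fa fb Tz TL) (form_closure_submod fa fb Tz TL).

Definition closure_type fa fb Tz TL := {w : V | w \in form_closure fa fb Tz TL}.
HB.instance Definition _ fa fb Tz TL := SubChoice.on (closure_type fa fb Tz TL).
HB.instance Definition _ fa fb Tz TL :=
  [SubChoice_isSubLmodule of closure_type fa fb Tz TL by <:].

Lemma closure_psd fa fb Tz TL (f : V -> V -> R) : psd_form f ->
  psd_form (fun v w : closure_type fa fb Tz TL => f (\val v) (\val w)).
Proof.
move=> [lin sym pos]; split=> [c u v w|u v|u]; [|exact: sym|exact: pos].
exact: lin.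
Qed.

Lemma closure_complete fa fb Tz TL : form_complete a b ->
  form_complete (fun v w : closure_type fa fb Tz TL => a (\val v) (\val w))
                (fun v w : closure_type fa fb Tz TL => b (\val v) (\val w)).
Proof.
move=> cplt w_ wC; have [|w [aw bw]] := cplt (fun n => \val (w_ n)); first exact: wC.
suff h : w \in form_closure fa fb Tz TL by exists (exist _ w h).
rewrite inE => eps eps0; have e8 : 0 < eps / 8 by rewrite divr_gt0.
move/cvgrPdist_le : (aw) => /(_ _ e8) he; move/cvgrPdist_le : (bw) => /(_ _ e8) hm.
have : \forall n \near \oo,
   a (\val (w_ n) - w) (\val (w_ n) - w) + b (\val (w_ n) - w) (\val (w_ n) - w) <= eps / 4.
  near=> n.
  have : `|0 - a (\val (w_ n) - w) (\val (w_ n) - w)| <= eps / 8 by near: n.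
  have : `|0 - b (\val (w_ n) - w) (\val (w_ n) - w)| <= eps / 8 by near: n.
  rewrite !sub0r !normrN !ger0_norm ?(psd_ge0 fa) ?(psd_ge0 fb)//; lra.
move=> [n _ /(_ _ (leqnn _)) wnw].
have := valP (w_ n); rewrite /= inE => /(_ (eps / 4)).
rewrite divr_gt0// => /(_ isT)[t tt twn]; exists t => //.
rewrite -(subrK (\val (w_ n)) t) -addrA.
rewrite (le_trans (lerD (psd_add_le _ _ fa) (psd_add_le _ _ fb)))//.
move: wnw twn; lra.
Unshelve. all: by end_near. Qed.

End FormClosure.

(** * Triples consisting of a function and its gradient, over an abstract inner product *)

Section Triples.
Context (R : realType) (L : lmodType R) (dot : L -> L -> R).
Hypothesis dotP : psd_form dot.
Local Notation V := (L * L * L)%type.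

(** A triple [(u, p, q)] stands for a function with its weak gradient. Keeping the gradient as
    separate components reduces completeness to that of [L], one component at a time. *)
Definition energy (w w' : V) : R := dot w.1.2 w'.1.2 + dot w.2 w'.2.
Definition mass (w w' : V) : R := dot w.1.1 w'.1.1.

Lemma mass_psd : psd_form mass.
Proof.
have [lin sym pos] := dotP.
split=> [c u v w|u v|u]; [exact: (lin c u.1.1)|exact: (sym u.1.1)|exact: (pos u.1.1)].
Qed.

Lemma energy_psd : psd_form energy.
Proof.
have [lin sym pos] := dotP.
split=> [c u v w|u v|u]; rewrite /energy.
- by rewrite /= !lin; ring.
- by rewrite sym (sym v.2).
- by rewrite addr_ge0.
Qed.

Lemma dot_le_energy_mass (w : V) :
  [/\ dot w.1.1 w.1.1 <= energy w w + mass w w,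
      dot w.1.2 w.1.2 <= energy w w + mass w w
    & dot w.2 w.2 <= energy w w + mass w w].
Proof.
have := psd_ge0 dotP w.1.1; have := psd_ge0 dotP w.1.2.
have := psd_ge0 dotP w.2; rewrite /energy /mass.
by move: (dot _ _) (dot _ _) (dot _ _) => x y z; split; lra.
Qed.

Lemma triple_complete :
  (forall u_ : nat -> L,
     (forall eps, 0 < eps -> exists N, forall m n, (N <= m)%N -> (N <= n)%N ->
        dot (u_ m - u_ n) (u_ m - u_ n) <= eps) ->
     exists u, dot (u_ n - u) (u_ n - u) @[n --> \oo] --> 0) ->
  form_complete energy mass.
Proof.
move=> cplt w_ wC.
have sub3 (n : V -> L) : (forall u v, n (u - v) = n u - n v) ->
    (forall u, dot (n u) (n u) <= energy u u + mass u u) ->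
    exists f : L, dot (n (w_ k) - f) (n (w_ k) - f) @[k --> \oo] --> 0.
  move=> nB nle; apply: cplt => eps eps0; have [N HN] := wC _ eps0.
  exists N => m k Nm Nk; rewrite -nB (le_trans (nle _))//.
  exact: HN.
have [|w|u hu] := sub3 (fun w => w.1.1) _; [by []|by have [] := dot_le_energy_mass w|].
have [|w|p hp] := sub3 (fun w => w.1.2) _; [by []|by have [] := dot_le_energy_mass w|].
have [|w|q hq] := sub3 (fun w => w.2) _; [by []|by have [] := dot_le_energy_mass w|].
exists (u, p, q); split; last exact: hu.
by rewrite -[X in _ --> X](addr0 0); apply: cvgD; [exact: hp|exact: hq].
Qed.

Lemma triple_limitP (T : V -> Prop) (w : V) : form_limit energy mass T w <->
  exists t : nat -> V, [/\ forall n, T (t n),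
    dot ((t n).1.1 - w.1.1) ((t n).1.1 - w.1.1) @[n --> \oo] --> 0,
    dot ((t n).1.2 - w.1.2) ((t n).1.2 - w.1.2) @[n --> \oo] --> 0
  & dot ((t n).2 - w.2) ((t n).2 - w.2) @[n --> \oo] --> 0].
Proof.
have pos u : 0 <= dot u u := psd_ge0 dotP u.
split=> [hw|[t [Tt cu cp cq]] eps eps0].
  have /choice[t Ht] : forall n, exists t, T t /\
      energy (t - w) (t - w) + mass (t - w) (t - w) <= n.+1%:R^-1.
    move=> n; have n0 : 0 < n.+1%:R^-1 :> R by rewrite invr_gt0.
    by have [t ? ?] := hw _ n0; exists t.
  have tn n : energy (t n - w) (t n - w) + mass (t n - w) (t n - w) <= n.+1%:R^-1.
    by have [] := Ht n.
  exists t; split; first by move=> n; have [] := Ht n.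
  - apply: eps_cvg0 => n; rewrite pos (le_trans _ (tn n))//.
    by have [] := dot_le_energy_mass (t n - w).
  - apply: eps_cvg0 => n; rewrite pos (le_trans _ (tn n))//.
    by have [] := dot_le_energy_mass (t n - w).
  - apply: eps_cvg0 => n; rewrite pos (le_trans _ (tn n))//.
    by have [] := dot_le_energy_mass (t n - w).
have : energy (t n - w) (t n - w) + mass (t n - w) (t n - w) @[n --> \oo] --> 0.
  rewrite -[X in _ --> X](addr0 0); apply: cvgD; last exact: cu.
  by rewrite -[X in _ --> X](addr0 0); apply: cvgD; [exact: cp|exact: cq].
move/cvgrPdist_le => /(_ _ eps0)[n _ /(_ _ (leqnn _))] /=.
rewrite sub0r normrN => /(le_trans (ler_norm _)) tnw.
by exists (t n).
Qed.

(** Both sides of the inequality assumed on [T] are continuous for the energy and mass norms, so it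
    survives in the closure. *)
Lemma triple_compact (T : V -> Prop) (Tz : T 0)
    (TL : forall c u v, T u -> T v -> T (c *: u + v)) :
  (forall eps, 0 < eps -> exists (N : nat) (chi : 'I_N -> L), forall t, T t ->
     mass t t <= eps * energy t t + \sum_(i < N) dot t.1.1 (chi i) ^+ 2) ->
  let W := closure_type energy_psd mass_psd Tz TL in
  form_compact (fun v w : W => energy (\val v) (\val w))
               (fun v w : W => mass (\val v) (\val w)).
Proof.
move=> Tc W eps eps0; have [N [chi Hchi]] := Tc _ eps0.
(* One constant has to serve all functionals; the sum dominates each Cauchy-Schwarz constant
   [dot (chi i) (chi i)]. *)
exists N, (fun i w => dot (\val w).1.1 (chi i)), (\sum_(i < N) dot (chi i) (chi i)).
split.
- move=> i u v; rewrite -(psdNl dotP) -(psdDl dotP).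
  by [].
- move=> i u; rewrite (le_trans (psd_CS dotP _ _))// mulrC.
  rewrite ler_wpM2r ?(psd_ge0 dotP)// (bigD1 i)//= lerDl.
  by apply: sumr_ge0 => j _; exact: psd_ge0.
move=> w; have /= := valP w; rewrite inE => /triple_limitP[t [Tt cu cp cq]].
have cm := psd_cvg dotP cu.
have ce : eps * energy (t n) (t n) + \sum_(i < N) dot (t n).1.1 (chi i) ^+ 2
    @[n --> \oo] --> eps * energy (\val w) (\val w) +
      \sum_(i < N) dot (\val w).1.1 (chi i) ^+ 2.
  apply: cvgD.
    apply: cvgM; first exact: cvg_cst.
    by apply: cvgD; [exact: (psd_cvg dotP cp)|exact: (psd_cvg dotP cq)].
  apply: cvg_big => [|i _]; first exact: add_continuous.
  apply: (cvg_comp _ (fun x => x ^+ 2)); last exact: exprn_continuous.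
  exact: (psd_cvgl dotP cu).
apply: (@ler_cvg_to _ _ _ _ _ _ _ _ cm ce).
by near=> n; exact: Hchi.
Unshelve. all: by end_near. Qed.

(** Orthogonality for both forms lets the Rayleigh bound of each trial vector pass to their whole
    span, term by term. *)
Lemma triple_minmax (T : V -> Prop) (n : nat) (v : 'I_n -> V) (lambda : R) :
  T 0 -> (forall c u v, T u -> T v -> T (c *: u + v)) ->
  (forall u_ : nat -> L,
     (forall eps, 0 < eps -> exists N, forall m n, (N <= m)%N -> (N <= n)%N ->
        dot (u_ m - u_ n) (u_ m - u_ n) <= eps) ->
     exists u, dot (u_ n - u) (u_ n - u) @[n --> \oo] --> 0) ->
  (forall eps, 0 < eps -> exists (N : nat) (chi : 'I_N -> L), forall t, T t ->
     mass t t <= eps * energy t t + \sum_(i < N) dot t.1.1 (chi i) ^+ 2) ->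
  (forall i, T (v i)) ->
  (forall i j, i != j -> mass (v i) (v j) = 0) ->
  (forall i j, i != j -> energy (v i) (v j) = 0) ->
  (forall i, 0 < mass (v i) (v i)) ->
  (forall i, energy (v i) (v i) <= lambda * mass (v i) (v i)) ->
  exists (e : nat -> V) (mu : nat -> R),
    [/\ forall i, form_limit energy mass T (e i),
        forall i j, (i < n)%N -> (j < n)%N -> mass (e i) (e j) = (i == j)%:R,
        forall i, (i < n)%N -> mu i <= lambda
      & forall i w, (i < n)%N -> form_limit energy mass T w ->
          energy (e i) w = mu i * mass (e i) w].
Proof.
move=> Tz TL cplt cpct Tv m0 e0 pos ray.
have vlam c : let w := \sum_(i < n) c i *: v i in energy w w <= lambda * mass w w.
  rewrite /= (psd_orthogonal_sum energy_psd c e0) (psd_orthogonal_sum mass_psd c m0).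
  rewrite mulr_sumr; apply: ler_sum => i _.
  by rewrite mulrCA ler_wpM2l// sqr_ge0.
have vfree c : let w := \sum_(i < n) c i *: v i in mass w w = 0 -> forall i, c i = 0.
  rewrite /= (psd_orthogonal_sum mass_psd c m0) => /eqP.
  rewrite psumr_eq0 => [/allP c0 i|j _]; last by rewrite mulr_ge0 ?sqr_ge0// ltW.
  have := c0 i (mem_index_enum _).
  by rewrite /= mulf_eq0 (gt_eqF (pos i)) orbF sqrf_eq0 => /eqP.
pose W := closure_type energy_psd mass_psd Tz TL.
have vW i : v i \in form_closure energy_psd mass_psd Tz TL.
  rewrite inE => eps eps0; exists (v i) => //.
  by rewrite subrr (psd0l energy_psd) (psd0l mass_psd) addr0 ltW.
pose vv i : W := exist _ (v i) (vW i).
have valv c : \val (\sum_(i < n) c i *: vv i) = \sum_(i < n) c i *: v i.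
  by rewrite raddf_sum; apply: eq_bigr.
have [||e [mu [eo mule eeig]]] := minmax_eigenvectors
  (closure_psd energy_psd mass_psd Tz TL energy_psd)
  (closure_psd energy_psd mass_psd Tz TL mass_psd)
  (closure_complete (fa := energy_psd) (fb := mass_psd) (Tz := Tz) (TL := TL)
     (triple_complete cplt))
  (triple_compact Tz TL cpct) (v := vv) (lambda := lambda).
- by move=> c /=; rewrite valv; exact: vlam.
- by move=> c /=; rewrite valv; exact: vfree.
exists (fun i => \val (e i)), mu; split => //.
- by move=> i; have := valP (e i); rewrite inE.
- move=> i w iN hw; have wW : w \in form_closure energy_psd mass_psd Tz TL by rewrite inE.
  exact: (eeig i (exist _ w wW)).
Qed.

End Triples.

(** * The Dirichlet form in the plane *)

Lemma le1_2 (R : realType) : (1 <= 2%:E :> \bar R)%E.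
Proof. by rewrite lee_fin ler1n. Qed.

(** * The inner product of L^2 *)

Section SquareIntegrable.
Context d (T : measurableType d) (R : realType) (mu : {measure set T -> \bar R}).
Local Notation L := (LfunType mu (le1_2 R)).
Implicit Types (u v w : T -> R).

Definition L2dot u v : R := \int[mu]_z (u z * v z).

Lemma L2_measurable u : u \in Lfun mu 2%:E -> measurable_fun setT u.
Proof. by rewrite inE => /andP[/[!inE]]. Qed.

Lemma L2_integrable_mul u v : u \in Lfun mu 2%:E -> v \in Lfun mu 2%:E ->
  mu.-integrable setT (EFin \o (fun z => u z * v z)).
Proof. by move=> u2 v2; apply/Lfun1_integrable; exact: Lfun2_mul_Lfun1. Qed.

Lemma L2dotC u v : L2dot u v = L2dot v u.
Proof. by apply: eq_Rintegral => z _; rewrite mulrC. Qed.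

Lemma L2dot_ge0 u : 0 <= L2dot u u.
Proof. by apply: Rintegral_ge0 => z _; rewrite -expr2 sqr_ge0. Qed.

Lemma L2dot_linl c u v w : u \in Lfun mu 2%:E -> v \in Lfun mu 2%:E ->
  w \in Lfun mu 2%:E ->
  L2dot (fun z => c * u z + v z) w = c * L2dot u w + L2dot v w.
Proof.
move=> u2 v2 w2; rewrite /L2dot.
have uw := L2_integrable_mul u2 w2; have vw := L2_integrable_mul v2 w2.
under eq_Rintegral do rewrite mulrDl -mulrA.
rewrite RintegralD//; last first.
  have -> : EFin \o (fun z => c * (u z * w z)) =
      (fun z => (c%:E * (u z * w z)%R%:E)%E) by [].
  exact: integrableZl.
by rewrite RintegralZl.
Qed.

Lemma L2P u : measurable_fun setT u -> (\int[mu]_z (u z ^+ 2)%:E < +oo)%E ->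
  u \in Lfun mu 2%:E.
Proof.
move=> mu_ ui; rewrite inE; apply/andP; split; rewrite inE//= /finite_norm.
rewrite unlock /Lnorm poweR_lty//.
under eq_integral do rewrite /= powR_mulrn// real_normK ?num_real//.
by [].
Qed.

Lemma L2_integral_sqr u : u \in Lfun mu 2%:E ->
  (\int[mu]_z (u z ^+ 2)%:E)%E = (L2dot u u)%:E.
Proof.
move=> u2; rewrite /L2dot /Rintegral fineK; first by under eq_integral do rewrite expr2.
exact/integrable_fin_num/L2_integrable_mul.
Qed.

Lemma L2_Lnorm u : u \in Lfun mu 2%:E ->
  'N[mu]_2%:E[EFin \o u]%E = (Num.sqrt (L2dot u u))%:E.
Proof.
move=> u2; rewrite unlock /Lnorm.
under eq_integral do rewrite /= powR_mulrn// real_normK ?num_real//.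
by rewrite L2_integral_sqr// -powR12_sqrt// ?L2dot_ge0.
Qed.

Lemma L2dot_psd : psd_form (fun u v : L => L2dot u v).
Proof.
split=> [c u v w|u v|u]; [|exact: L2dotC|exact: L2dot_ge0].
by rewrite -L2dot_linl//; exact: LfunP.
Qed.

End SquareIntegrable.

Lemma summable_diff_cvg (R : realType) (x : nat -> R) (C : R) :
  (forall k, `|x k.+1 - x k| <= C * 2^-1 ^+ k) -> cvgn x.
Proof.
move=> xC; have C0 : 0 <= C.
  by have := le_trans (normr_ge0 _) (xC 0%N); rewrite expr0 mulr1.
have : cvgn (series (fun k => x k.+1 - x k)).
  apply: normed_cvg; apply: (@series_le_cvg _ _ (geometric C 2^-1)) => //.
  - by move=> n /=.
  - by move=> n; rewrite /geometric /= mulr_ge0// exprn_ge0.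
  - by apply: is_cvg_geometric_series; rewrite ger0_norm// invf_lt1// ltr1n.
move=> /cvg_ex[l xl]; apply/cvg_ex; exists (l + x 0%N).
have xE : x = (fun n => series (fun k => x k.+1 - x k) n + x 0%N).
  by apply/funext => n; rewrite /series /= telescope_sumr// subrK.
rewrite [X in X @ _ --> _]xE.
by apply: cvgD; [exact: xl|exact: cvg_cst].
Qed.

(** * Completeness of L^2 (Riesz-Fischer) *)

Section Complete.
Context d (T : measurableType d) (R : realType) (mu : {measure set T -> \bar R}).
Local Notation L := (LfunType mu (le1_2 R)).

(** The series [S] of the [4 ^ k * (u k.+1 - u k) ^ 2] has integral at most the sum of the
    [4 ^ (- k)], so it is finite almost everywhere; where it is, the increments are at most
    [sqrt S * 2 ^ (- k)]. *)
Lemma ae_cvg_of_fast (u : nat -> T -> R) :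
  (forall k, measurable_fun setT (u k)) ->
  (forall k, (\int[mu]_z ((u k.+1 z - u k z) ^+ 2)%:E <= (16^-1 ^+ k)%:E)%E) ->
  {ae mu, forall z, cvgn (u ^~ z)}.
Proof.
move=> mu_ ui.
pose t k z : \bar R := (4 ^+ k * (u k.+1 z - u k z) ^+ 2)%:E.
pose S z : \bar R := (\sum_(0 <= k <oo) t k z)%E.
have mt k : measurable_fun setT (t k).
  apply/measurable_EFinP; apply: measurable_funM => //.
  by apply: measurable_funX; exact: measurable_funB.
have t0 k z : (0 <= t k z)%E.
  by rewrite lee_fin mulr_ge0// sqr_ge0.
have Soo : (\int[mu]_z S z < +oo)%E.
  rewrite integral_nneseries//.
  apply: (@le_lt_trans _ _ (\sum_(0 <= k <oo) (geometric 1 4^-1 k)%:E)%E).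
    apply: lee_nneseries => [k _ _|k _]; first exact: integral_ge0.
    under eq_integral do rewrite /t EFinM.
    rewrite ge0_integralZl//; last 2 first.
    - apply/measurable_EFinP/measurable_funX; exact: measurable_funB.
    - by move=> z _; rewrite lee_fin sqr_ge0.
    apply: (@le_trans _ _ ((4 ^+ k)%:E * (16^-1 ^+ k)%:E)%E).
      by rewrite lee_wpmul2l// lee_fin.
    rewrite -EFinM lee_fin /geometric /= mul1r -exprMn.
    by have -> : 4 * 16^-1 = 4^-1 :> R by field.
  have -> : (fun n => \sum_(0 <= k < n) (geometric 1 4^-1 k)%:E)%E =
      EFin \o series (geometric (1 : R) 4^-1).
    by apply/funext => n; rewrite /= sumEFin.
  rewrite EFin_lim ?ltry//; apply: is_cvg_geometric_series.
  by rewrite ger0_norm// invf_lt1// ltr1n.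
have mS : measurable_fun setT S.
  by apply: ge0_emeasurable_sum => // k _ _; exact: t0.
have S0 z : (0 <= S z)%E by apply: nneseries_ge0.
have Sint : mu.-integrable setT S.
  apply/integrableP; split => //.
  by under eq_integral do rewrite gee0_abs//.
have := integrable_ae measurableT Sint.
apply: filterS => z /(_ Logic.I) Sz.
apply: (@summable_diff_cvg _ _ (Num.sqrt (fine (S z)))) => k.
have fS0 : 0 <= fine (S z) by rewrite fine_ge0.
rewrite -(@ler_pXn2r _ 2)// ?nnegrE ?mulr_ge0 ?sqrtr_ge0 ?exprn_ge0//.
rewrite real_normK ?num_real// exprMn sqr_sqrtr// -exprM mulnC exprM.
have -> : 2^-1 ^+ 2 = 4^-1 :> R by field.
rewrite exprVn ler_pdivlMr ?exprn_gt0// mulrC -lee_fin fineK//.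
rewrite /S (nneseries_split _ k.+1)// add0n.
rewrite big_nat_recr//= -addeA addeCA leeDl// adde_ge0//.
  by apply: sume_ge0.
by apply: nneseries_ge0.
Unshelve. all: by end_near. Qed.

Lemma limn_einf_le (x : nat -> \bar R) (C : \bar R) :
  (\forall n \near \oo, (x n <= C)%E) -> (limn_einf x <= C)%E.
Proof.
move=> xC; rewrite limn_einf_lim; apply: lime_le; first exact: is_cvg_einfs.
near=> n; apply: (@le_trans _ _ (x n)); last by near: n.
by apply: ereal_inf_lbound; exists n => /=.
Unshelve. all: by end_near. Qed.

Lemma L2_complete (u_ : nat -> L) :
  (forall eps, 0 < eps -> exists N, forall m n, (N <= m)%N -> (N <= n)%N ->
     L2dot mu (u_ m - u_ n) (u_ m - u_ n) <= eps) ->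
  exists u : L, L2dot mu (u_ n - u) (u_ n - u) @[n --> \oo] --> 0.
Proof.
move=> uC.
have /choice[N_ HN] : forall k, exists N, forall m n, (N <= m)%N -> (N <= n)%N ->
    L2dot mu (u_ m - u_ n) (u_ m - u_ n) <= 16^-1 ^+ k.
  by move=> k; apply: uC; rewrite exprn_gt0.
(* Summing the thresholds makes [phi] nondecreasing and above both [N_ k] and [k]. *)
pose phi k := (\sum_(i < k.+1) N_ i + k)%N.
have phiN k : (N_ k <= phi k)%N.
  by rewrite /phi big_ord_recr/= -addnA addnCA leq_addr.
have phiS k : (phi k <= phi k.+1)%N.
  by rewrite /phi [in leqRHS]big_ord_recr/= -addnA leq_add2l addnS leqW// leq_addl.
have phik k : (k <= phi k)%N by rewrite leq_addl.
have mfun (f : L) : measurable_fun setT f by exact/L2_measurable/LfunP.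
have sqrE m n : (\int[mu]_z ((u_ m z - u_ n z) ^+ 2)%:E =
    (L2dot mu (u_ m - u_ n) (u_ m - u_ n))%:E)%E.
  by rewrite -L2_integral_sqr//; exact: (LfunP (u_ m - u_ n)).
have cv : {ae mu, forall z, cvgn (fun k => u_ (phi k) z)}.
  apply: (@ae_cvg_of_fast (fun k z => u_ (phi k) z)) => k //=.
  rewrite sqrE lee_fin; apply: HN; last exact: phiN.
  exact: leq_trans (phiN _) (phiS _).
(* An upper limit is measurable on the whole space, including the null set where the subsequence
   diverges; [fine] makes it real-valued there. *)
pose v z := fine (limn_esup (fun k => (u_ (phi k) z)%:E)).
have mv : measurable_fun setT v.
  apply: (measurableT_comp (fine_measurable measurableT)).
  by apply: measurable_fun_limn_esup => k; exact/measurable_EFinP.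
have vE : {ae mu, forall z, u_ (phi k) z @[k --> \oo] --> v z}.
  apply: filterS cv => z cz.
  have ez : (u_ (phi k) z)%:E @[k --> \oo] --> (limn (fun k => u_ (phi k) z))%:E.
    by apply: cvg_EFin; [near=> k|].
  by rewrite /v (cvg_limn_einf_sup ez).2.
have close eps : 0 < eps -> exists N, forall j, (N <= j)%N ->
    (\int[mu]_z ((u_ j z - v z) ^+ 2)%:E <= eps%:E)%E.
  move=> eps0; have [N uN] := uC _ eps0; exists N => j Nj.
  pose f k z : \bar R := ((u_ j z - u_ (phi k) z) ^+ 2)%:E.
  have mf k : measurable_fun setT (f k).
    by apply/measurable_EFinP/measurable_funX; exact: measurable_funB.
  (* Fatou along the subsequence: almost everywhere the integrand is the lower limit of the [f k],
     whose integrals are at most [eps] for large [k]. *)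
  apply: (@le_trans _ _ (\int[mu]_z limn_einf (f ^~ z))%E).
    apply: ae_ge0_le_integral => //.
    - by move=> z _; rewrite lee_fin sqr_ge0.
    - by apply/measurable_EFinP/measurable_funX; exact: measurable_funB.
    - move=> z _; rewrite limn_einf_lim; apply: lime_ge; first exact: is_cvg_einfs.
      by near=> k; apply/ereal_infP => _ [m _ <-]; rewrite lee_fin sqr_ge0.
    - by apply: measurableT_comp => //; apply: measurable_fun_limn_esup => k;
        apply: measurableT_comp.
    apply: filterS vE => z vz _.
    have : f k z @[k --> \oo] --> ((u_ j z - v z) ^+ 2)%:E.
      apply: cvg_EFin; first by near=> k.
      by apply: (cvg_comp _ (fun x => x ^+ 2)); [apply: cvgB; [exact: cvg_cst|exact: vz]|exact: exprn_continuous].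
    by move=> /cvg_limn_einf_sup[-> _].
  apply: (le_trans (fatou _ _ _ _)) => //.
    by move=> k z _; rewrite lee_fin sqr_ge0.
  apply: limn_einf_le; near=> k; rewrite /f sqrE lee_fin; apply: uN => //.
  apply: leq_trans (phik k); near: k; exact: nbhs_infty_ge.
have [N1 HN1] := close 1 ltr01.
have uv2 : (fun z => u_ N1 z - v z) \in Lfun mu 2%:E.
  apply: L2P; first exact: measurable_funB.
  by rewrite (le_lt_trans (HN1 _ (leqnn _)))// ltry.
(* Square integrability has been obtained for [u_ N1 - v], so the limit is recovered as an element
   of [L] by subtraction. *)
pose w : L := u_ N1 - Lfun_Sub (le1_2 R) uv2.
have wE z : w z = v z.
  have -> : w z = u_ N1 z - (Lfun_Sub (le1_2 R) uv2 : L) z by [].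
  by rewrite Lfun_valP opprB addrCA subrr addr0.
exists w; apply/cvgrPdist_le => eps eps0; have [N HN'] := close _ eps0.
near=> n; rewrite sub0r normrN ger0_norm ?L2dot_ge0// -lee_fin.
rewrite -L2_integral_sqr; last exact: (LfunP (u_ n - w)).
apply: le_trans (HN' n _); last by near: n; exact: nbhs_infty_ge.
by rewrite le_eqVlt; apply/orP; left; apply/eqP/eq_integral => z _; rewrite -wE.
Unshelve. all: by end_near. Qed.

End Complete.

Notation plane R := (R * R)%type.
Notation leb2 R := (@lebesgue_measure R \x @lebesgue_measure R)%E.

(** * Measurability and square integrability of continuous functions in the plane *)

Section Plane.
Context (R : realType).
Implicit Types (f : plane R -> R).

(** Measurability refers to the product sigma-algebra, so [U] is written as a countable union of
    products of balls with rational centres and radii. A radius of at most half of that of a ball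
    inside [U] keeps the box around a nearby rational centre within [U]. *)
Lemma open_plane_measurable (U : set (plane R)) : open U -> measurable U.
Proof.
move=> oU.
pose box (a b e : rat) := (ball (ratr a : R) (ratr e) `*` ball (ratr b : R) (ratr e)).
have -> : U = \bigcup_a \bigcup_b \bigcup_(e in [set e | box a b e `<=` U]) box a b e.
  apply/seteqP; split => [z Uz|z [a _ [b _ [e /= abe]]]]; last exact: abe.
  have /nbhs_ballP[eps /= eps0 zU] : nbhs z U by exact: open_nbhs_nbhs.
  have [r r0 reps] : exists2 r : rat, 0 < ratr r :> R & ratr r *+ 2 <= eps.
    have [r] := @rat_in_itvoo R 0 (eps / 2) ltac:(by rewrite divr_gt0).
    rewrite in_itv/= => /andP[r0 re]; exists r => //.
    by rewrite -mulr_natr -ler_pdivlMr// ltW.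
  have near_rat (x : R) : exists q : rat, `|x - ratr q| < ratr r.
    have [q] := @rat_in_itvoo R (x - ratr r) (x + ratr r) ltac:(lra).
    rewrite in_itv/= => /andP[? ?]; exists q.
    by rewrite ltr_norml; apply/andP; split; lra.
  have [a za] := near_rat z.1; have [b zb] := near_rat z.2.
  exists a => //; exists b => //; exists r; last first.
    by split; rewrite /= /ball/= distrC.
  move=> w [wa wb]; apply: zU; rewrite /= in wa wb; split; rewrite /ball/=.
    have -> : z.1 - w.1 = (z.1 - ratr a) + (ratr a - w.1) by ring.
    rewrite (le_lt_trans (ler_normD _ _))// (lt_le_trans _ reps)// mulr2n.
    exact: ltrD.
  have -> : z.2 - w.2 = (z.2 - ratr b) + (ratr b - w.2) by ring.
  rewrite (le_lt_trans (ler_normD _ _))// (lt_le_trans _ reps)// mulr2n.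
  exact: ltrD.
apply: bigcupT_measurable_rat => a; apply: bigcupT_measurable_rat => b.
rewrite bigcup_mkcond; apply: bigcupT_measurable_rat => e; case: ifPn => // _.
by apply: measurableX; exact: measurable_ball.
Qed.

Lemma continuous_plane_measurable f : continuous f -> measurable_fun setT f.
Proof.
move=> cf; apply: (measurability _ (RGenOpens.measurableE R)) => //.
move=> _ [_ [a [b ->]] <-]; rewrite setTI; apply: open_plane_measurable.
by apply: open_comp => // z _; exact: cf.
Qed.

Lemma compact_support_box f : compact (closure [set z | f z != 0]) ->
  exists2 M : R, 0 < M & forall z, f z != 0 -> `|z.1| <= M /\ `|z.2| <= M.
Proof.
move=> /compact_bounded [M [_ MK]].
have M1 : M < `|M| + 1 by rewrite (le_lt_trans (ler_norm _))// ltrDl.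
exists (`|M| + 1) => [|z fz]; first by rewrite ltr_wpDl.
have zK : closure [set z | f z != 0] z by apply: subset_closure.
have := MK _ M1 z zK.
by rewrite /= {1}/Num.norm /= ge_max => /andP.
Qed.

Lemma compact_support_bounded f : continuous f ->
  compact (closure [set z | f z != 0]) ->
  exists2 C : R, 0 <= C & forall z, `|f z| <= C.
Proof.
move=> cf fK; have cfK : {within closure [set z | f z != 0], continuous f}.
  exact: continuous_subspaceT.
have /compact_bounded[C [_ fC]] := continuous_compact cfK fK.
have C1 : C < `|C| + 1 by rewrite (le_lt_trans (ler_norm _))// ltrDl.
exists (`|C| + 1) => [|z]; first by rewrite addr_ge0.
have [->|fz] := eqVneq (f z) 0; first by rewrite normr0 addr_ge0.
by apply: (fC _ C1 (f z)); exists z => //; exact: subset_closure.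
Qed.

Lemma compact_support_L2 f : continuous f ->
  compact (closure [set z | f z != 0]) -> f \in Lfun (leb2 R) 2%:E.
Proof.
move=> cf fK; apply: L2P; first exact: continuous_plane_measurable.
have [M M0 fM] := compact_support_box fK.
have [C C0 fC] := compact_support_bounded cf fK.
pose B : set (plane R) := `[- M, M] `*` `[- M, M].
have mB : measurable B by exact: measurableX.
apply: (@le_lt_trans _ _ (\int[leb2 R]_z ((C ^+ 2)%:E * (\1_B z)%:E))%E).
  apply: ge0_le_integral => //.
  - by move=> z _; rewrite lee_fin sqr_ge0.
  - by apply/measurable_EFinP/measurable_funX; exact: continuous_plane_measurable.
  - by apply/measurable_EFinP; apply: measurable_funM => //; exact: measurable_indic.
  move=> z _; rewrite -EFinM lee_fin indicE; have [zB|zB] := boolP (z \in B).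
    by rewrite mulr1 -real_normK ?num_real// lerXn2r// nnegrE.
  have [->|/fM[z1 z2]] := eqVneq (f z) 0; first by rewrite expr0n mulr0.
  by move/negP : zB; case; rewrite inE /B/= !in_itv/= -!ler_norml.
rewrite ge0_integralZl//; last 2 first.
- by apply/measurable_EFinP; exact: measurable_indic.
- by rewrite lee_fin sqr_ge0.
rewrite integral_indic// setIT.
have BE : leb2 R B = ((M *+ 2) * (M *+ 2))%:E.
  rewrite /B product_measure1E//= !lebesgue_measure_itv/= lte_fin gtrN//.
  by rewrite -!EFinB -!EFinM opprK -mulr2n.
by rewrite [X in (_ * X)%E]BE -EFinM ltry.
Qed.

End Plane.

(** * The vector space of test functions *)

Section TestFunctions.
Context (R : realType).
Implicit Types (phi psi : plane R -> R) (U : set (plane R)).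

(** Off the closed support the function vanishes in a neighbourhood, and so does its derivative. *)
Lemma derive_support phi (v z : plane R) :
  'D_v phi z != 0 -> closure [set z | phi z != 0] z.
Proof.
apply: contra_neqP => nz.
have -> : 'D_v phi z = 'D_v (fun=> 0) z.
  apply: near_eq_derive.
  move/existsNP : nz => [B /not_implyP[zB AB]].
  apply: filterS zB => w Bw; apply: contra_notP AB => /eqP fw.
  by exists w.
by rewrite derive_cst.
Qed.

Lemma compact_derive_support phi (v : plane R) :
  compact (closure [set z | phi z != 0]) ->
  compact (closure [set z | 'D_v phi z != 0]).
Proof.
move=> Kphi; apply: subclosed_compact Kphi _; first exact: closed_closure.
rewrite [X in _ `<=` X](_ : _ = closure (closure [set z | phi z != 0])).
  by apply: closure_subset => z; exact: derive_support.
by apply/closure_id; exact: closed_closure.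
Qed.

Lemma derive_lin phi psi (c : R) (v z : plane R) :
  derivable phi z v -> derivable psi z v ->
  derivable (fun z => c * phi z + psi z) z v /\
  'D_v (fun z => c * phi z + psi z) z = c * 'D_v phi z + 'D_v psi z.
Proof.
move=> dphi dpsi.
have -> : (fun z => c * phi z + psi z) = (c *: phi) + psi by [].
have dc : derivable (c *: phi) z v := derivableZ dphi.
split; first exact: derivableD dc dpsi.
by rewrite (deriveD dc dpsi) deriveZ.
Qed.

Lemma partial_lin k phi psi c : classC k.+1 phi -> classC k.+1 psi ->
  partialx (fun z => c * phi z + psi z) = (fun z => c * partialx phi z + partialx psi z) /\
  partialy (fun z => c * phi z + psi z) = (fun z => c * partialy phi z + partialy psi z).
Proof.
move=> [_ dphi _ _] [_ dpsi _ _]; split; apply/funext => z.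
  exact: (derive_lin c (dphi z).1 (dpsi z).1).2.
exact: (derive_lin c (dphi z).2 (dpsi z).2).2.
Qed.

Lemma continuous_lin phi psi c : continuous phi -> continuous psi ->
  continuous (fun z => c * phi z + psi z).
Proof.
move=> cphi cpsi z; apply: cvgD; last exact: cpsi.
by apply: cvgM; [exact: cvg_cst|exact: cphi].
Qed.

Lemma classC_lin k phi psi c : classC k phi -> classC k psi ->
  classC k (fun z => c * phi z + psi z).
Proof.
elim: k phi psi => [|k IH] phi psi Cphi Cpsi; first exact: continuous_lin.
have [px py] := partial_lin c Cphi Cpsi.
case: Cphi Cpsi => [cphi dphi x1 y1] [cpsi dpsi x2 y2]; split.
- exact: continuous_lin.
- move=> z; split.
    exact: (derive_lin c (dphi z).1 (dpsi z).1).1.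
  exact: (derive_lin c (dphi z).2 (dpsi z).2).1.
- by rewrite px; exact: IH.
- by rewrite py; exact: IH.
Qed.

Lemma test_function_lin U phi psi c : test_function U phi ->
  test_function U psi -> test_function U (fun z => c * phi z + psi z).
Proof.
move=> [C1 K1 S1] [C2 K2 S2].
have sub : closure [set z | c * phi z + psi z != 0] `<=`
    closure [set z | phi z != 0] `|` closure [set z | psi z != 0].
  rewrite -closureU; apply: closure_subset => z /=.
  apply: contra_neqP => /not_orP[/negP/negPn/eqP-> /negP/negPn/eqP->].
  by rewrite mulr0 addr0.
split.
- by move=> k; exact: classC_lin.
- apply: subclosed_compact sub; first exact: closed_closure.
  exact: compactU.
- by move=> z /sub[/S1|/S2].
Qed.

Lemma test_function0 U : test_function U (fun=> 0).
Proof.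
have s0 : closure [set z : plane R | (0 : R) != 0] = set0.
  by rewrite (_ : [set z | _] = set0) ?closure0//; apply/seteqP; split => // z /=; rewrite eqxx.
split; [|by rewrite s0; exact: compact0|by rewrite s0].
elim=> [|k IH] /=; first exact: cst_continuous.
have p0 (v : plane R) : (fun z => 'D_v (fun=> 0 : R) z) = fun=> 0.
  by apply/funext => z; rewrite derive_cst.
split=> //; first exact: cst_continuous.
- by rewrite /partialx p0.
- by rewrite /partialy p0.
Qed.

Lemma test_function_L2 U phi : test_function U phi ->
  [/\ phi \in Lfun (leb2 R) 2%:E, partialx phi \in Lfun (leb2 R) 2%:E
    & partialy phi \in Lfun (leb2 R) 2%:E].
Proof.
move=> [Cphi Kphi _]; have [cphi _ /= cx cy] := Cphi 1%N.
have K (v : plane R) := compact_derive_support (v := v) Kphi.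
split; first exact: compact_support_L2 cphi Kphi.
- exact: compact_support_L2 cx (K (1, 0)).
- exact: compact_support_L2 cy (K (0, 1)).
Qed.

End TestFunctions.

(** * H^1_0 as a closure of triples *)

Section SobolevSpace.
Context (R : realType).
Local Notation L := (LfunType (leb2 R) (le1_2 R)).
Local Notation V := (L * L * L)%type.
Local Notation dot := (fun u v : L => @L2dot _ _ R (leb2 R) u v).
Implicit Type U : set (plane R).

Definition test_triple U (w : V) : Prop :=
  [/\ test_function U w.1.1, w.1.2 = partialx w.1.1 :> (plane R -> R)
    & w.2 = partialy w.1.1 :> (plane R -> R)].

Lemma test_triple_lin U c u v : test_triple U u -> test_triple U v ->
  test_triple U (c *: u + v).
Proof.
move=> [tu xu yu] [tv xv yv].
have [Cu _ _] := tu; have [Cv _ _] := tv.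
have [px py] := partial_lin c (Cu 1%N) (Cv 1%N).
split.
- exact: (test_function_lin c tu tv).
- by rewrite [RHS]px -xu -xv.
- by rewrite [RHS]py -yu -yv.
Qed.

Lemma test_triple0 U : test_triple U 0.
Proof.
have t0 := @test_function0 R U.
have p0 v : (fun z : plane R => 'D_v (fun=> 0 : R) z) = fun=> 0.
  by apply/funext => z; rewrite derive_cst.
by split; [exact: t0|rewrite [RHS]p0|rewrite [RHS]p0].
Qed.

Lemma L2_cvgP (f_ : nat -> L) (f : L) :
  L2_cvg (fun n => f_ n) f <-> dot (f_ n - f) (f_ n - f) @[n --> \oo] --> 0.
Proof.
rewrite /L2_cvg.
have -> : (fun n => 'N[(leb2 R)%E]_2%:E[EFin \o (f_ n \- f)%R])%E =
    EFin \o (fun n => Num.sqrt (dot (f_ n - f) (f_ n - f))).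
  by apply/funext => n /=; rewrite -L2_Lnorm//; exact: (LfunP (f_ n - f)).
split=> [/fine_cvg /= h|h].
  have -> : (fun n => dot (f_ n - f) (f_ n - f)) = (fun n =>
      Num.sqrt (dot (f_ n - f) (f_ n - f)) ^+ 2).
    by apply/funext => n; rewrite sqr_sqrtr// L2dot_ge0.
  rewrite (_ : 0 = 0 ^+ 2 :> R); last by rewrite expr0n.
  by apply: (cvg_comp _ (fun x => x ^+ 2)); [exact: h|exact: exprn_continuous].
apply: cvg_EFin; first by near=> n.
rewrite -(sqrtr0 R).
by apply: (cvg_comp _ (@Num.sqrt R)); [exact: h|exact: sqrt_continuous].
Unshelve. all: by end_near. Qed.

Lemma L2_lift : exists mk : forall f : plane R -> R, f \in Lfun (leb2 R) 2%:E -> L,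
  forall f f2, mk f f2 = f :> (plane R -> R).
Proof.
by exists (fun f f2 => Lfun_Sub (le1_2 R) f2) => f f2; rewrite Lfun_valP.
Qed.

Lemma test_triple_of U phi : test_function U phi ->
  exists2 t, test_triple U t & t.1.1 = phi :> (plane R -> R).
Proof.
move=> tphi; have [mk mkE] := L2_lift; have [a2 b2 c2] := test_function_L2 tphi.
exists (mk _ a2, mk _ b2, mk _ c2); last by rewrite /= mkE.
by split; rewrite /= !mkE.
Qed.

(** The bridge between the sequential definition of H^1_0 and the closure to which the abstract
    min-max applies. *)
Lemma H10P U (u p q : plane R -> R) : H10 U u p q <->
  exists w : V, [/\ form_limit (energy dot) (mass dot) (test_triple U) w,
    w.1.1 = u :> (plane R -> R),
    w.1.2 = p :> (plane R -> R) & w.2 = q :> (plane R -> R)].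
Proof.
split=> [[u2 p2 q2 [phi [tphi cu cp cq]]]|].
  have [mk mkE] := L2_lift; pose w : V := (mk u u2, mk p p2, mk q q2).
  exists w; split; rewrite /w /= ?mkE//; apply/(triple_limitP (L2dot_psd (leb2 R))).
  have /choice[t Ht] : forall n, exists t : V, test_triple U t /\ t.1.1 = phi n :> (plane R -> R).
    by move=> n; have [t] := test_triple_of (tphi n); exists t.
  have t1 : (fun n => (t n).1.1 : plane R -> R) = phi.
    by apply/funext => n; have [_] := Ht n.
  have t2 : (fun n => (t n).1.2 : plane R -> R) = fun n => partialx (phi n).
    by apply/funext => n; have [[_ -> _] ->] := Ht n.
  have t3 : (fun n => (t n).2 : plane R -> R) = fun n => partialy (phi n).
    by apply/funext => n; have [[_ _ ->] ->] := Ht n.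
  exists t; split; first by move=> n; have [] := Ht n.
  - by apply/(@L2_cvgP (fun n => (t n).1.1)); rewrite t1 /= mkE.
  - by apply/(@L2_cvgP (fun n => (t n).1.2)); rewrite t2 /= mkE.
  - by apply/(@L2_cvgP (fun n => (t n).2)); rewrite t3 /= mkE.
move=> [w [/(triple_limitP (L2dot_psd (leb2 R)))[t [Tt cu cp cq]] <- <- <-]].
split; [exact: LfunP|exact: LfunP|exact: LfunP|].
move: t Tt cu cp cq; rewrite -/(nat -> V) => t Tt cu cp cq.
exists (fun n => (t n).1.1 : L); split.
- by move=> n; have [] := Tt n.
- exact/(@L2_cvgP (fun n => (t n).1.1)).
- have <- : (fun n => (t n).1.2 : plane R -> R) = fun n => partialx (t n).1.1.
    by apply/funext => n; have [] := Tt n.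
  exact/(@L2_cvgP (fun n => (t n).1.2)).
- have <- : (fun n => (t n).2 : plane R -> R) = fun n => partialy (t n).1.1.
    by apply/funext => n; have [] := Tt n.
  exact/(@L2_cvgP (fun n => (t n).2)).
Qed.

End SobolevSpace.

Lemma sum_count_undup (T : eqType) (s : seq T) :
  (\sum_(x <- undup s) count_mem x s)%N = size s.
Proof.
rewrite -sum1_size -[RHS]big_undup_iterop_count /=.
by apply: eq_bigr => x _; rewrite Monoid.iteropE iter_addn_0 mul1n.
Qed.

Lemma L2dot_ae0 d (T : measurableType d) (R : realType)
    (mu : {measure set T -> \bar R}) (f g : T -> R) :
  measurable_fun setT f -> measurable_fun setT g ->
  {ae mu, forall z, f z = 0} -> L2dot mu f g = 0.
Proof.
move=> mf mg f0; rewrite /L2dot /Rintegral (ae_eq_integral (cst 0%E))//.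
- by rewrite integral0.
- by apply/measurable_EFinP; exact: measurable_funM.
- by apply: filterS f0 => z fz _ /=; rewrite fz mul0r.
Qed.

(** * From trial functions to the counting function *)

Section Count.
Context (R : realType).
Local Notation L := (LfunType (leb2 R) (le1_2 R)).
Local Notation V := (L * L * L)%type.
Local Notation dot := (fun u v : L => @L2dot _ _ R (leb2 R) u v).
Implicit Type U : set (plane R).

Lemma L_sumE (n : nat) (c : 'I_n -> R) (e : 'I_n -> L) z :
  (\sum_(i < n) c i *: e i : L) z = \sum_(i < n) c i * e i z.
Proof.
by elim/big_rec2: _ => [//|i x y _ <-].
Qed.

(** The eigenvectors are grouped by eigenvalue: those with the same value [x] are free modulo null
    sets, so their number is at most the multiplicity of [x]. Summing over the distinct values
    returns [n]. *)
Lemma dirichlet_count_ge U (lambda : R) (n : nat) (e : nat -> V) (mu : nat -> R) :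
  (forall i, form_limit (energy dot) (mass dot) (test_triple U) (e i)) ->
  (forall i j, (i < n)%N -> (j < n)%N -> mass dot (e i) (e j) = (i == j)%:R) ->
  (forall i, (i < n)%N -> mu i <= lambda) ->
  (forall i w, (i < n)%N -> form_limit (energy dot) (mass dot) (test_triple U) w ->
          energy dot (e i) w = mu i * mass dot (e i) w) ->
  (n%:R%:E <= dirichlet_count U lambda)%E.
Proof.
move=> eH eo mule eeig.
have eigen i : (i < n)%N -> dirichlet_eigenspace U (mu i) (e i).1.1.
  move=> iN; exists (e i).1.2, (e i).2; split.
    by apply/H10P; exists (e i); split.
  move=> v r s /H10P[w [hw <- <- <-]]; exact: (eeig i w iN hw).
pose m := [seq mu i | i <- iota 0 n].
have mult x : ((count_mem x m)%:R%:E <= multiplicity U x)%E.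
  pose s := [seq i <- iota 0 n | mu i == x].
  have sN j : (j < size s)%N -> (nth 0%N s j < n)%N /\ mu (nth 0%N s j) = x.
    move=> js; have := mem_nth 0%N js; rewrite mem_filter mem_iota add0n => /andP[/eqP -> /=].
    by [].
  have us : uniq s by rewrite filter_uniq ?iota_uniq.
  have -> : count_mem x m = size s by rewrite /m count_map size_filter.
  apply: ereal_sup_ubound; exists (size s) => //=.
  exists (fun j => (e (nth 0%N s j)).1.1).
    by move=> j; have [jN <-] := sN j (ltn_ord j); exact: eigen.
  move=> c c0 l.
  pose f : L := \sum_(j < size s) c j *: (e (nth 0%N s j)).1.1.
  have [ln _] := sN l (ltn_ord l).
  (* Orthonormality recovers each coefficient as a pairing, which is 0 when the combination vanishes
     almost everywhere. *)
  have <- : L2dot (leb2 R) f (e (nth 0%N s l)).1.1 = c l.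
    have := psd_suml (L2dot_psd (leb2 R)) (index_enum 'I_(size s)) xpredT
       (fun j => c j *: (e (nth 0%N s j)).1.1) (e (nth 0%N s l)).1.1.
    rewrite -/f => ->; rewrite (bigD1 l)//= big1 => [|j jl].
      have -> := psdZl (L2dot_psd (leb2 R)) (c l) (e (nth 0%N s l)).1.1 (e (nth 0%N s l)).1.1.
      by rewrite [X in _ * X](eo _ _ ln ln) eqxx mulr1 addr0.
    have [jn _] := sN j (ltn_ord j).
    have -> := psdZl (L2dot_psd (leb2 R)) (c j) (e (nth 0%N s j)).1.1 (e (nth 0%N s l)).1.1.
    by rewrite [X in _ * X](eo _ _ jn ln) nth_uniq//; have /negPf-> : (j : nat) != l by []; rewrite mulr0.
  have fE : (f : plane R -> R) = fun z => \sum_(j < size s) c j * (e (nth 0%N s j)).1.1 z.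
    by apply/funext => z; rewrite /f L_sumE.
  have mf : measurable_fun setT (f : plane R -> R) by exact: (L2_measurable (LfunP f)).
  rewrite fE in mf *; apply: L2dot_ae0; [exact: mf| |exact: c0].
  exact: (L2_measurable (LfunP (e (nth 0%N s l)).1.1)).
rewrite /dirichlet_count; apply: esum_ge.
exists [set` undup m].
  split; first exact: finite_seq.
  move=> x /=; rewrite mem_undup => /mapP[i]; rewrite mem_iota add0n => /= iN ->.
  exact: mule.
rewrite -fsbig_seq ?undup_uniq//=.
apply: (@le_trans _ _ (\sum_(x <- undup m) (count_mem x m)%:R%:E)%E); last first.
  by apply: lee_sum => x _; exact: mult.
by rewrite sumEFin -natr_sum sum_count_undup size_map size_iota.
Qed.

(** [form_compact] with L^2 pairings as functionals, required of test functions only;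
    [triple_compact] carries it over to H^1_0. *)
Definition compactly_embedded U := forall eps, 0 < eps ->
  exists (N : nat) (chi : 'I_N -> L), forall phi, test_function U phi ->
    L2_dot phi phi <= eps * (L2_dot (partialx phi) (partialx phi) +
                             L2_dot (partialy phi) (partialy phi)) +
      \sum_(i < N) L2_dot phi (chi i) ^+ 2.

Lemma L2dot_disjoint (f g : plane R -> R) : (forall z, f z != 0 -> g z = 0) ->
  L2dot (leb2 R) f g = 0.
Proof.
move=> fg; rewrite /L2dot /Rintegral integral0_eq// => z _.
by have [->|/fg ->] := eqVneq (f z) 0; rewrite ?mul0r ?mulr0.
Qed.

(** The sets [S i] contain the closed supports, hence also the points where the gradients are
    nonzero, so the trial functions are orthogonal for the mass and for the energy. *)
Lemma disjoint_trial_count U (lambda : R) (n : nat) (phi : 'I_n -> plane R -> R)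
    (S : 'I_n -> set (plane R)) :
  compactly_embedded U ->
  (forall i, test_function U (phi i)) ->
  (forall i, closure [set z | phi i z != 0] `<=` S i) ->
  (forall i j z, S i z -> S j z -> i = j) ->
  (forall i, 0 < L2_dot (phi i) (phi i)) ->
  (forall i, L2_dot (partialx (phi i)) (partialx (phi i)) +
             L2_dot (partialy (phi i)) (partialy (phi i)) <=
             lambda * L2_dot (phi i) (phi i)) ->
  (n%:R%:E <= dirichlet_count U lambda)%E.
Proof.
move=> cpct tphi phiS Sd pos ray.
have /choice[v Hv] : forall i, exists t : V, test_triple U t /\ t.1.1 = phi i :> (plane R -> R).
  by move=> i; have [t] := test_triple_of (tphi i); exists t.
have vt i : test_triple U (v i) by have [] := Hv i.
have v1 i : (v i).1.1 = phi i :> (plane R -> R) by have [] := Hv i.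
have v2 i : (v i).1.2 = partialx (phi i) :> (plane R -> R).
  by have [_ -> _] := vt i; rewrite v1.
have v3 i : (v i).2 = partialy (phi i) :> (plane R -> R).
  by have [_ _ ->] := vt i; rewrite v1.
have psd := L2dot_psd (leb2 R).
have inS i z : phi i z != 0 -> S i z by move=> ?; apply: phiS; exact: subset_closure.
have dS i d z : 'D_d (phi i) z != 0 -> S i z by move=> /derive_support; exact: phiS.
have m0 i j : i != j -> mass dot (v i) (v j) = 0.
  move=> ij; rewrite /mass v1 v1; apply: L2dot_disjoint => z /inS iz.
  by apply: contra_neq_eq ij => /inS; exact: Sd.
have e0 i j : i != j -> energy dot (v i) (v j) = 0.
  move=> ij; rewrite /energy v2 v2 v3 v3 !L2dot_disjoint ?addr0// => z /dS iz.
    by apply: contra_neq_eq ij => /dS; exact: Sd.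
  by apply: contra_neq_eq ij => /dS; exact: Sd.
have mi i : mass dot (v i) (v i) = L2_dot (phi i) (phi i) by rewrite /mass v1.
have ei i : energy dot (v i) (v i) =
    L2_dot (partialx (phi i)) (partialx (phi i)) +
    L2_dot (partialy (phi i)) (partialy (phi i)) by rewrite /energy v2 v3.
have [|||e [mu [eH eo mule eeig]]] := triple_minmax psd (v := v) (lambda := lambda)
  (test_triple0 U) (@test_triple_lin R U) (@L2_complete _ _ _ _) _ vt m0 e0.
- move=> eps /cpct[N [chi Hchi]]; exists N, chi => t [tt tx ty].
  by rewrite /mass /energy tx ty; exact: Hchi.
- by move=> i; rewrite mi; exact: pos.
- by move=> i; rewrite mi ei; exact: ray.
exact: (dirichlet_count_ge eH eo mule eeig).
Qed.

End Count.

(** * Compactness of the embedding of H^1_0 in L^2 *)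

Section IntervalIntegral.
Context (R : realType).
Local Notation mu := (@lebesgue_measure R).
Implicit Types (f g : R -> R) (a b c x y s M : R).

Definition itg a b f : R := \int[mu]_(x in `[a, b]) f x.

Lemma itg_integrable a b f : continuous f -> mu.-integrable `[a, b] (EFin \o f).
Proof.
move=> cf; apply: continuous_compact_integrable; first exact: segment_compact.
exact: continuous_subspaceT.
Qed.

Lemma itg_EFin a b f : continuous f ->
  (\int[mu]_(x in `[a, b]) (f x)%:E)%E = (itg a b f)%:E.
Proof.
by move=> cf; rewrite /itg /Rintegral fineK//; apply: integrable_fin_num => //; exact: itg_integrable.
Qed.

Lemma itgD a b f g : continuous f -> continuous g ->
  itg a b (fun x => f x + g x) = itg a b f + itg a b g.
Proof. by move=> cf cg; rewrite /itg RintegralD//; exact: itg_integrable. Qed.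

Lemma itgZ a b c f : continuous f -> itg a b (fun x => c * f x) = c * itg a b f.
Proof. by move=> cf; rewrite /itg RintegralZl//; exact: itg_integrable. Qed.

Lemma itg_cst a b c : a <= b -> itg a b (fun=> c) = c * (b - a).
Proof.
move=> ab; rewrite /itg Rintegral_cst//= lebesgue_measure_itv/= lte_fin.
have [//|ba] := ltP a b; rewrite /=.
have -> : a = b by apply/eqP; rewrite eq_le ab.
by rewrite subrr.
Qed.

Lemma itg_le a b f g : continuous f -> continuous g ->
  (forall x, a <= x <= b -> f x <= g x) -> itg a b f <= itg a b g.
Proof.
move=> cf cg fg; by apply: le_Rintegral => //; exact: itg_integrable.
Qed.

Lemma itg_ge0 a b f : (forall x, a <= x <= b -> 0 <= f x) -> 0 <= itg a b f.
Proof. by move=> f0; apply: Rintegral_ge0 => x /=; rewrite in_itv/=; exact: f0. Qed.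

Lemma itg_subset a b x y f : continuous f -> (forall z, 0 <= f z) ->
  a <= x -> y <= b -> itg x y f <= itg a b f.
Proof.
move=> cf f0 ax yb; rewrite -lee_fin -!itg_EFin//; apply: ge0_subset_integral => //.
- by apply/measurable_EFinP/measurable_funTS; exact: continuous_measurable_fun.
- by move=> z _; rewrite lee_fin.
- by apply: subset_itv; rewrite bnd_simp.
Qed.

Lemma continuous_const c : continuous ((fun=> c) : R -> R).
Proof. by move=> x; exact: cvg_cst. Qed.

Lemma continuous_mul f g : continuous f -> continuous g -> continuous (fun x => f x * g x).
Proof. by move=> cf cg x; apply: cvgM; [exact: cf|exact: cg]. Qed.

Lemma continuous_sqr f : continuous f -> continuous (fun x => f x ^+ 2).
Proof. by move=> cf; exact: continuous_mul. Qed.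

Lemma continuous_sub f g : continuous f -> continuous g -> continuous (fun x => f x - g x).
Proof. by move=> cf cg x; apply: cvgB; [exact: cf|exact: cg]. Qed.

Lemma itg_variance a b f m : a <= b -> continuous f ->
  itg a b (fun x => (f x - m) ^+ 2) =
  itg a b (fun x => f x ^+ 2) - m * itg a b f *+ 2 + m ^+ 2 * (b - a).
Proof.
move=> ab cf.
have -> : (fun x => (f x - m) ^+ 2) =
    (fun x => f x ^+ 2 + ((- m *+ 2) * f x + m ^+ 2)).
  by apply/funext => x; ring.
have ccst := continuous_const (c := m ^+ 2).
have cm : continuous (fun x => (- m *+ 2) * f x).
  by apply: continuous_mul => //; exact: continuous_const.
have cs : continuous (fun x => (- m *+ 2) * f x + m ^+ 2).
  by move=> x; apply: cvgD; [exact: cm|exact: ccst].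
rewrite itgD; [|exact: continuous_sqr|exact: cs].
rewrite itgD; [|exact: cm|exact: ccst].
by rewrite itgZ// itg_cst//; ring.
Qed.

(** The variance around the mean value is nonnegative. *)
Lemma itg_CS a b f : a < b -> continuous f ->
  itg a b f ^+ 2 <= (b - a) * itg a b (fun x => f x ^+ 2).
Proof.
move=> ab cf; have ba : 0 < b - a by rewrite subr_gt0.
have := @itg_variance a b f (itg a b f / (b - a)) (ltW ab) cf.
have : 0 <= itg a b (fun x => (f x - itg a b f / (b - a)) ^+ 2).
  by apply: itg_ge0 => x _; rewrite sqr_ge0.
move=> /[swap] ->.
set I := itg a b f; set Q := itg a b _.
have -> : Q - I / (b - a) * I *+ 2 + (I / (b - a)) ^+ 2 * (b - a) = Q - I ^+ 2 / (b - a).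
  by field; rewrite gt_eqF.
by rewrite subr_ge0 ler_pdivrMr// mulrC.
Qed.

Lemma itg_FTC a b f f' : a < b -> (forall x, is_derive x 1 f (f' x)) ->
  continuous f' -> itg a b f' = f b - f a.
Proof.
move=> ab df cf'; apply: EFin_inj; rewrite -itg_EFin//.
have cf : continuous f.
  by move=> x; apply/differentiable_continuous/derivable1_diffP; have [] := df x.
rewrite (@continuous_FTC2 _ _ f)//.
- exact: continuous_subspaceT.
- split; [by move=> x _; have [] := df x| |].
  + exact/cvg_at_right_filter/cf.
  + exact/cvg_at_left_filter/cf.
- by move=> x _; rewrite derive1E; have [] := df x.
Qed.

(* [itg_mean] bounds the distance of [f] to its mean value; together with
   [itg_osc] it is the one-dimensional Poincare inequality. *)
Lemma itg_osc a b f f' x y : a < b -> (forall x, is_derive x 1 f (f' x)) ->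
  continuous f' -> a <= x <= b -> a <= y <= b ->
  (f x - f y) ^+ 2 <= (b - a) * itg a b (fun x => f' x ^+ 2).
Proof.
move=> ab df cf'.
have I0 : 0 <= itg a b (fun x => f' x ^+ 2) by apply: itg_ge0 => z _; exact: sqr_ge0.
wlog xy : x y / y < x => [hw|/andP[ax xb] /andP[ay yb]].
  have [yx|xy|->] := ltgtP y x; first exact: hw.
    by move=> ? ?; rewrite -sqrrN opprB; exact: hw.
  by rewrite subrr expr0n /= mulr_ge0// subr_ge0 ltW.
rewrite -(itg_FTC xy df cf').
rewrite (le_trans (itg_CS xy cf'))//; apply: ler_pM.
- by rewrite subr_ge0 ltW.
- by apply: itg_ge0 => z _; exact: sqr_ge0.
- by rewrite lerB.
- by apply: itg_subset => // [|z]; [exact: continuous_sqr|exact: sqr_ge0].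
Qed.

Lemma itg_mean a b f M : a < b -> continuous f ->
  (forall x y, a <= x <= b -> a <= y <= b -> (f x - f y) ^+ 2 <= M) ->
  itg a b (fun x => f x ^+ 2) <= (b - a)^-1 * itg a b f ^+ 2 + (b - a) * M.
Proof.
move=> ab cf fM; have ba : 0 < b - a by rewrite subr_gt0.
set m := itg a b f / (b - a).
have cst := continuous_const.
have fm x : a <= x <= b -> (f x - m) ^+ 2 <= M.
  move=> xab; have -> : f x - m = (b - a)^-1 * itg a b (fun y => f x - f y).
    have -> : (fun y => f x - f y) = (fun y => f x + (-1) * f y).
      by apply/funext => y; rewrite mulN1r.
    rewrite itgD ?itgZ ?itg_cst ?(ltW ab)//; last by apply: continuous_mul.
    by rewrite /m; field; rewrite gt_eqF.
  have cxf : continuous (fun y => f x - f y) by exact: continuous_sub.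
  rewrite exprMn; have := itg_CS ab cxf => h.
  rewrite (le_trans (ler_wpM2l _ h)) ?sqr_ge0//.
  have : itg a b (fun y => (f x - f y) ^+ 2) <= M * (b - a).
    rewrite -itg_cst ?(ltW ab)//; apply: itg_le => //; first exact: continuous_sqr.
    by move=> y yab; exact: fM.
  set Q := itg a b _ => h'.
  have -> : (b - a)^-1 ^+ 2 * ((b - a) * Q) = Q / (b - a) by field; rewrite gt_eqF.
  by rewrite ler_pdivrMr.
have := @itg_variance a b f m (ltW ab) cf.
have : itg a b (fun x => (f x - m) ^+ 2) <= M * (b - a).
  rewrite -itg_cst ?(ltW ab)//; apply: itg_le => //.
  by apply: continuous_sqr; exact: continuous_sub.
move=> /[swap] ->; rewrite /m.
set I := itg a b f; set Q := itg a b _.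
have -> : Q - I / (b - a) * I *+ 2 + (I / (b - a)) ^+ 2 * (b - a) = Q - (b - a)^-1 * I ^+ 2.
  by field; rewrite gt_eqF.
by rewrite lerBlDl [(b - a) * M]mulrC.
Qed.

Lemma itg_poincare0 a b f f' x0 : a < b -> (forall x, is_derive x 1 f (f' x)) ->
  continuous f' -> a <= x0 <= b -> f x0 = 0 ->
  itg a b (fun x => f x ^+ 2) <= (b - a) ^+ 2 * itg a b (fun x => f' x ^+ 2).
Proof.
move=> ab df cf' x0ab fx0.
have cf : continuous f.
  by move=> x; apply/differentiable_continuous/derivable1_diffP; have [] := df x.
rewrite expr2 -mulrA [leRHS]mulrC -itg_cst ?(ltW ab)//; apply: itg_le.
- exact: continuous_sqr.
- exact: continuous_const.
- by move=> x xab; rewrite -[f x]subr0 -fx0; exact: itg_osc.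
Qed.

End IntervalIntegral.

(** * Iterated integrals over rectangles *)

Section RectangleIntegral.
Context (R : realType).
Local Notation mu := (@lebesgue_measure R).
Implicit Types (F : plane R -> R) (a b c e x y : R).

(** The bound is the dominating constant that makes partial integrals continuous and gives
    integrability on bounded rectangles. *)
Definition bounded_continuous F := continuous F /\ exists C, forall z, `|F z| <= C.

Lemma bounded_continuous_mul F G : bounded_continuous F -> bounded_continuous G ->
  bounded_continuous (fun z => F z * G z).
Proof.
move=> [cF [C FC]] [cG [D GD]]; split.
  by move=> z; apply: cvgM; [exact: cF|exact: cG].
by exists (C * D) => z; rewrite normrM ler_pM.
Qed.

Lemma bounded_continuous_sqr F : bounded_continuous F ->
  bounded_continuous (fun z => F z ^+ 2).
Proof. by move=> bF; exact: bounded_continuous_mul. Qed.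

Lemma continuous_slicex F y : continuous F -> continuous (fun x => F (x, y)).
Proof.
move=> cF x; apply: (cvg_comp (fun x => (x, y)) F); last exact: cF.
apply: (@cvg_pair _ _ _ (nbhs x) (nbhs x) (nbhs y) _ _ _ id (fun=> y)).
  exact: cvg_id.
exact: cvg_cst.
Qed.

Lemma continuous_slicey F x : continuous F -> continuous (fun y => F (x, y)).
Proof.
move=> cF y; apply: (cvg_comp (fun y => (x, y)) F); last exact: cF.
apply: (@cvg_pair _ _ _ (nbhs y) (nbhs x) (nbhs y) _ _ _ (fun=> x) id).
  exact: cvg_cst.
exact: cvg_id.
Qed.

Lemma continuous_param_itg (f : R -> R -> R) a b (C : R) :
  (forall y, continuous (f y)) -> (forall x, continuous (f ^~ x)) ->
  (forall y x, `|f y x| <= C) ->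
  continuous (fun y => itg a b (f y)).
Proof.
move=> cy cx fC y; suff h u v : {in (`]u, v[%classic : set R), continuous (fun y => itg a b (f y))}.
  apply: (h (y - 1) (y + 1)); rewrite inE/= in_itv/=; apply/andP; split; lra.
apply: (@continuity_under_integral R _ _ mu f `[a, b] _ u v _ _ (fun=> C)) => //.
- by move=> z _; exact: itg_integrable.
- by apply: aeW => x _ z _; exact: cx.
- by apply: itg_integrable; exact: continuous_const.
- by move=> z _; apply: aeW => x _; exact: fC.
Qed.

Lemma continuous_itgx F a b : bounded_continuous F ->
  continuous (fun y => itg a b (fun x => F (x, y))).
Proof.
move=> [cF [C FC]]; apply: (@continuous_param_itg (fun y x => F (x, y)) a b C).
- by move=> y; exact: continuous_slicex.
- by move=> x; exact: continuous_slicey.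
- by move=> y x; exact: FC.
Qed.

Lemma continuous_itgy F c e : bounded_continuous F ->
  continuous (fun x => itg c e (fun y => F (x, y))).
Proof.
move=> [cF [C FC]]; apply: (@continuous_param_itg (fun x y => F (x, y)) c e C).
- by move=> y; exact: continuous_slicey.
- by move=> x; exact: continuous_slicex.
- by move=> y x; exact: FC.
Qed.

(** Half-open, so that the cells of a grid are disjoint and leave no gap. *)
Definition rect a b c e : set (plane R) := `[a, b[ `*` `[c, e[.

Lemma measurable_rect a b c e : measurable (rect a b c e).
Proof. by apply: measurableX. Qed.

Lemma rect_finite a b c e : (leb2 R (rect a b c e) < +oo)%E.
Proof.
rewrite /rect product_measure1E//= !lebesgue_measure_itv/=.
by case: ifPn => _; case: ifPn => _; rewrite ?mule0 ?mul0e// -!EFinB -EFinM ltry.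
Qed.

Lemma rect_integrable F a b c e : bounded_continuous F ->
  (leb2 R).-integrable (rect a b c e) (EFin \o F).
Proof.
move=> [cF [C FC]]; apply: measurable_bounded_integrable.
- exact: measurable_rect.
- exact: rect_finite.
- by apply: measurable_funTS; exact: continuous_plane_measurable.
- exists C; split; first exact: num_real.
  by move=> M CM z _; apply: le_trans (FC z) (ltW CM).
Qed.

Lemma itg_half_open a b (f : R -> R) : continuous f ->
  (\int[mu]_(x in `[a, b[) (f x)%:E)%E = (itg a b f)%:E.
Proof.
move=> cf; rewrite integral_itv_bndo_bndc ?itg_EFin//.
by apply/measurable_EFinP/measurable_funTS; exact: continuous_measurable_fun.
Qed.

Lemma rect_integral_xy F a b c e : bounded_continuous F ->
  (\int[leb2 R]_(z in rect a b c e) (F z)%:E)%E =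
  (itg a b (fun x => itg c e (fun y => F (x, y))))%:E.
Proof.
move=> bF; have [cF _] := bF.
have mQ := measurable_rect a b c e.
have iF := rect_integrable a b c e bF.
rewrite integral_mkcond -itg_half_open; last exact: continuous_itgy.
rewrite -integral12_prod_meas1; last first.
  by move: iF; rewrite integrable_mkcond//.
rewrite [RHS]integral_mkcond; apply: eq_integral => x _.
rewrite /fubini_F /patch; case: ifPn => xab.
  rewrite -itg_half_open; last exact: continuous_slicey.
  rewrite [RHS]integral_mkcond; apply: eq_integral => y _; rewrite /patch.
  by rewrite /rect in_setX xab.
by rewrite integral0_eq// => y _; rewrite /rect in_setX (negPf xab).
Qed.

Lemma rect_integral_yx F a b c e : bounded_continuous F ->
  (\int[leb2 R]_(z in rect a b c e) (F z)%:E)%E =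
  (itg c e (fun y => itg a b (fun x => F (x, y))))%:E.
Proof.
move=> bF; have [cF _] := bF.
have mQ := measurable_rect a b c e.
have iF := rect_integrable a b c e bF.
rewrite integral_mkcond -itg_half_open; last exact: continuous_itgx.
rewrite -integral21_prod_meas1; last first.
  by move: iF; rewrite integrable_mkcond//.
rewrite [RHS]integral_mkcond; apply: eq_integral => y _.
rewrite /fubini_G /patch; case: ifPn => yce.
  rewrite -itg_half_open; last exact: continuous_slicex.
  rewrite [RHS]integral_mkcond; apply: eq_integral => x _; rewrite /patch.
  by rewrite /rect in_setX yce andbT.
by rewrite integral0_eq// => x _; rewrite /rect in_setX (negPf yce) andbF.
Qed.

End RectangleIntegral.

(** * The Poincare inequality on a square *)

Section SquarePoincare.
Context (R : realType).
Implicit Types (phi px py : plane R -> R).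

Lemma is_derive_slicex phi (x y : R) : derivable phi (x, y) (1, 0) ->
  is_derive x 1 (fun x => phi (x, y)) (partialx phi (x, y)).
Proof.
have E : (fun h : R => h^-1 *: ((phi \o shift (x, y)) (h *: (1, 0)) - phi (x, y))) =
    (fun h : R => h^-1 *: (((fun x => phi (x, y)) \o shift x) (h *: 1) - phi (x, y))).
  apply/funext => h /=; congr (_ *: (phi _ - _)).
  by congr pair; rewrite /= scaler0 add0r.
by rewrite /derivable E => d; split => //; rewrite /partialx /derive E.
Qed.

Lemma is_derive_slicey phi (x y : R) : derivable phi (x, y) (0, 1) ->
  is_derive y 1 (fun y => phi (x, y)) (partialy phi (x, y)).
Proof.
have E : (fun h : R => h^-1 *: ((phi \o shift (x, y)) (h *: (0, 1)) - phi (x, y))) =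
    (fun h : R => h^-1 *: (((fun y => phi (x, y)) \o shift y) (h *: 1) - phi (x, y))).
  apply/funext => h /=; congr (_ *: (phi _ - _)).
  by congr pair; rewrite /= scaler0 add0r.
by rewrite /derivable E => d; split => //; rewrite /partialy /derive E.
Qed.

Lemma itg_swap phi (a b c e : R) : bounded_continuous phi ->
  itg a b (fun x => itg c e (fun y => phi (x, y))) =
  itg c e (fun y => itg a b (fun x => phi (x, y))).
Proof. by move=> bphi; apply: EFin_inj; rewrite -rect_integral_xy// rect_integral_yx. Qed.

Definition itg2 (a b c e : R) phi : R :=
  itg c e (fun y => itg a b (fun x => phi (x, y))).

(** The one-dimensional inequality is used twice: in [x] on each horizontal slice, then in [y] for
    the slice integrals [X], whose oscillation is controlled by the [y]-derivative. *)
Lemma square_poincare phi px py (a c s : R) : 0 < s ->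
  bounded_continuous phi -> bounded_continuous px -> bounded_continuous py ->
  (forall x y : R, is_derive x 1 (fun x => phi (x, y)) (px (x, y))) ->
  (forall x y : R, is_derive y 1 (fun y => phi (x, y)) (py (x, y))) ->
  let DI := itg2 a (a + s) c (c + s) in
  is_true (DI (fun z => phi z ^+ 2) <= s^-1 ^+ 2 * DI phi ^+ 2 +
    s ^+ 2 * (DI (fun z => px z ^+ 2) + DI (fun z => py z ^+ 2))).
Proof.
move=> s0 bphi bpx bpy dx dy DI.
have aS : a < a + s by rewrite ltrDl.
have cS : c < c + s by rewrite ltrDl.
have aE : a + s - a = s by rewrite addrC addKr.
have cE : c + s - c = s by rewrite addrC addKr.
have b2 F : bounded_continuous F -> bounded_continuous (fun z => F z ^+ 2).
  exact: bounded_continuous_sqr.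
pose X y := itg a (a + s) (fun x => phi (x, y)).
have cX : continuous X by exact: continuous_itgx.
have slice y : itg a (a + s) (fun x => phi (x, y) ^+ 2) <=
    s^-1 * X y ^+ 2 + s ^+ 2 * itg a (a + s) (fun x => px (x, y) ^+ 2).
  have := @itg_mean R a (a + s) (fun x => phi (x, y))
    (s * itg a (a + s) (fun x => px (x, y) ^+ 2)) aS (continuous_slicex (y := y) bphi.1).
  rewrite aE expr2 mulrA; apply => x x' xab x'ab; rewrite -[X in X * _]aE.
  apply: (@itg_osc R a (a + s) _ (fun x => px (x, y))) => //; exact: (continuous_slicex bpx.1).
have X2 : itg c (c + s) (fun y => X y ^+ 2) <=
    s^-1 * DI phi ^+ 2 + s * (s ^+ 2 * DI (fun z => py z ^+ 2)).
  have := @itg_mean R c (c + s) X (s ^+ 2 * DI (fun z => py z ^+ 2)) cS cX.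
  rewrite cE; apply => y y' yab y'ab.
  have cphi' : continuous (fun x => phi (x, y) - phi (x, y')).
    by apply: continuous_sub; exact: (continuous_slicex bphi.1).
  have -> : X y - X y' = itg a (a + s) (fun x => phi (x, y) - phi (x, y')).
    have -> : (fun x => phi (x, y) - phi (x, y')) =
        (fun x => phi (x, y) + (-1) * phi (x, y')).
      by apply/funext => x; rewrite mulN1r.
    rewrite itgD ?itgZ ?mulN1r//; [exact: (continuous_slicex bphi.1)|exact: (continuous_slicex bphi.1)|].
    by apply: continuous_mul; [exact: continuous_const|exact: (continuous_slicex bphi.1)].
  rewrite (le_trans (itg_CS aS cphi'))// aE expr2 -mulrA ler_wpM2l ?(ltW s0)//.
  rewrite /DI /itg2; have /= <- := itg_swap a (a + s) c (c + s) (b2 _ _ bpy).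
  have cpy := continuous_itgy (c := c) (e := c + s) (b2 _ _ bpy); have cphi2 := continuous_sqr cphi'.
  rewrite -itgZ//.
  apply: itg_le => //.
    by apply: continuous_mul => //; exact: continuous_const.
  move=> x _; rewrite -[X in X * _]cE.
  apply: (@itg_osc R c (c + s) _ (fun y => py (x, y))) => //; exact: (continuous_slicey bpy.1).
have : DI (fun z => phi z ^+ 2) <= s^-1 * itg c (c + s) (fun y => X y ^+ 2) +
    s ^+ 2 * DI (fun z => px z ^+ 2).
  have c1 := continuous_itgx (a := a) (b := a + s) (b2 _ _ bphi).
  have c2 := continuous_itgx (a := a) (b := a + s) (b2 _ _ bpx).
  have c3 := continuous_sqr cX.
  have c4 := continuous_mul (continuous_const (c := s^-1)) c3.
  have c5 := continuous_mul (continuous_const (c := s ^+ 2)) c2.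
  rewrite /DI /itg2 -!itgZ// -itgD//; apply: itg_le => // y.
  by apply: cvgD; [exact: c4|exact: c5].
move=> /le_trans; apply.
have s1 : 0 <= s^-1 by rewrite invr_ge0 ltW.
rewrite (le_trans (lerD (ler_wpM2l s1 X2) (lexx _)))//.
move: (DI _) (DI _) => A B; rewrite le_eqVlt; apply/orP; left; apply/eqP; field.
by rewrite gt_eqF.
Qed.

End SquarePoincare.

(** * Comparing an integral with the sum of integrals over finitely many pieces *)

Section FiniteCover.
Context d (T : measurableType d) (R : realType) (mu : {measure set T -> \bar R}).
Context (I : finType) (D : I -> set T) (f : T -> \bar R).
Hypotheses (mD : forall i, measurable (D i)) (mf : measurable_fun setT f)
  (f0 : forall z, (0 <= f z)%E).

Lemma sum_integral_indic :
  (\sum_(i : I) \int[mu]_(z in D i) f z)%E = (\int[mu]_z \sum_(i : I) (f z * (\1_(D i) z)%:E))%E.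
Proof.
rewrite ge0_integral_sum//.
- by apply: eq_bigr => i _; rewrite integral_mkcond epatch_indic.
- by move=> i; apply: emeasurable_funM => //; apply/measurable_EFinP; exact: measurable_indic.
- by move=> i z _; rewrite mule_ge0// lee_fin.
Qed.

Lemma measurable_sum_indic : measurable_fun setT (fun z => (\sum_(i : I) (f z * (\1_(D i) z)%:E))%E).
Proof.
apply: emeasurable_sum => i _; apply: emeasurable_funM => //.
by apply/measurable_EFinP; exact: measurable_indic.
Qed.

Lemma integral_le_cover : (forall z, f z != 0%E -> exists i, D i z) ->
  (\int[mu]_z f z <= \sum_(i : I) \int[mu]_(z in D i) f z)%E.
Proof.
move=> cov; rewrite sum_integral_indic; apply: ge0_le_integral => //.
  exact: measurable_sum_indic.
move=> z _; have [->|/cov[i Di]] := eqVneq (f z) 0%E.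
  by apply: sume_ge0 => i _; rewrite mul0e.
rewrite (bigD1 i)//= indicE mem_set// mule1 leeDl//.
by apply: sume_ge0 => j _; rewrite mule_ge0// lee_fin.
Qed.

Lemma disjoint_le_integral : (forall i j z, D i z -> D j z -> i = j) ->
  (\sum_(i : I) \int[mu]_(z in D i) f z <= \int[mu]_z f z)%E.
Proof.
move=> dis; rewrite sum_integral_indic; apply: ge0_le_integral => //.
- by move=> z _; apply: sume_ge0 => i _; rewrite mule_ge0// lee_fin.
- exact: measurable_sum_indic.
move=> z _; have [[i Di]|noD] := pselect (exists i, D i z).
  rewrite (bigD1 i)//= big1 => [|j ji]; first by rewrite indicE mem_set// mule1 adde0.
  rewrite indicE memNset ?mule0// => Dj.
  by move/eqP : ji; apply; exact: dis Dj Di.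
rewrite big1 // => i _; rewrite indicE memNset ?mule0// => Di.
by apply: noD; exists i.
Qed.

End FiniteCover.

(** * Estimates for a test function on a cell and on the far end of the domain *)

Section TestFunctionEstimates.
Context (R : realType) (U : set (plane R)) (phi : plane R -> R).
Hypothesis tphi : test_function U phi.
Local Notation mu := (@lebesgue_measure R).

Lemma test_bounded_continuous : [/\ bounded_continuous phi,
  bounded_continuous (partialx phi) & bounded_continuous (partialy phi)].
Proof.
have [Cphi Kphi _] := tphi; have [cphi _ /= cx cy] := Cphi 1%N.
have K (v : plane R) := compact_derive_support (v := v) Kphi.
have bc f : continuous f -> compact (closure [set z | f z != 0]) -> bounded_continuous f.
  by move=> cf Kf; split => //; have [C _ fC] := compact_support_bounded cf Kf; exists C.
split; first exact: bc cphi Kphi.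
- exact: bc cx (K (1, 0)).
- exact: bc cy (K (0, 1)).
Qed.

Lemma test_slicex (x y : R) : is_derive x 1 (fun x => phi (x, y)) (partialx phi (x, y)).
Proof. by have [/(_ 1%N)[_ /(_ (x, y))[? _] _ _] _ _] := tphi; exact: is_derive_slicex. Qed.

Lemma test_slicey (x y : R) : is_derive y 1 (fun y => phi (x, y)) (partialy phi (x, y)).
Proof. by have [/(_ 1%N)[_ /(_ (x, y))[_ ?] _ _] _ _] := tphi; exact: is_derive_slicey. Qed.

Lemma test_support z : phi z != 0 -> U z.
Proof. by have [_ _ sU] := tphi => nz; apply: sU; exact: subset_closure. Qed.

Definition tail (X : R) : set (plane R) := `[X, +oo[ `*` setT.

Lemma measurable_tail X : measurable (tail X).
Proof. exact: measurableX. Qed.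

Lemma tail_integral (F : plane R -> R) X : continuous F ->
  (\int[leb2 R]_(z in tail X) (F z ^+ 2)%:E =
   \int[mu]_(x in `[X, +oo[) \int[mu]_y (F (x, y) ^+ 2)%:E)%E.
Proof.
move=> cF; have mF : measurable_fun setT (fun z => (F z ^+ 2)%:E : \bar R).
  by apply/measurable_EFinP; apply: measurable_funX; exact: continuous_plane_measurable.
have mT := measurable_tail X.
rewrite integral_mkcond fubini_tonelli1; last 2 first.
- rewrite epatch_indic; apply: emeasurable_funM => //.
  by apply/measurable_EFinP; exact: measurable_indic.
- by move=> z; rewrite patchE; case: ifPn => // _; rewrite lee_fin sqr_ge0.
rewrite [RHS]integral_mkcond; apply: eq_integral => x _.
rewrite /fubini_F /patch; case: ifPn => xX.
  by apply: eq_integral => y _; rewrite /tail in_setX xX in_setT.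
by rewrite integral0_eq// => y _; rewrite /tail in_setX (negPf xX).
Qed.

Lemma measurable_slice_integral (F : plane R -> R) (X : R) : continuous F ->
  measurable_fun `[X, +oo[ (fun x => \int[mu]_y (F (x, y) ^+ 2)%:E)%E.
Proof.
move=> cF; apply: measurable_funTS.
apply: (@measurable_fun_fubini_tonelli_F _ _ _ _ _ mu (fun z => (F z ^+ 2)%:E)).
  by apply/measurable_EFinP; apply: measurable_funX; exact: continuous_plane_measurable.
by move=> z; rewrite lee_fin sqr_ge0.
Qed.

(** Each vertical slice is supported in an interval of length [2 * delta] and vanishes at its
    endpoint [delta], so the one-dimensional Poincare inequality applies; integration in [x]
    follows. *)
Lemma tail_estimate (X delta : R) : 0 < delta ->
  (forall z, U z -> X <= z.1 -> `|z.2| < delta) ->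
  (\int[leb2 R]_(z in tail X) (phi z ^+ 2)%:E <=
   ((2 * delta) ^+ 2)%:E * \int[leb2 R]_(z in tail X) (partialy phi z ^+ 2)%:E)%E.
Proof.
move=> d0 Ud; have [[cphi _] _ [cy _]] := test_bounded_continuous.
rewrite !tail_integral// -ge0_integralZl//; last 3 first.
- exact: measurable_slice_integral.
- by move=> x _; apply: integral_ge0 => y _; rewrite lee_fin sqr_ge0.
- by rewrite lee_fin sqr_ge0.
apply: ge0_le_integral => //.
- by move=> x _; apply: integral_ge0 => y _; rewrite lee_fin sqr_ge0.
- exact: measurable_slice_integral.
- by apply: emeasurable_funM => //; exact: measurable_slice_integral.
move=> x; rewrite /= in_itv/= andbT => Xx.
have zero y : delta <= `|y| -> phi (x, y) = 0.
  move=> dy; apply/eqP; apply: contraTT dy => /test_support /Ud /(_ Xx) /=.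
  by rewrite -ltNge.
have cpx : continuous (fun y => phi (x, y)) by exact: continuous_slicey.
have cpy : continuous (fun y => partialy phi (x, y)) by exact: continuous_slicey.
have -> : (\int[mu]_y (phi (x, y) ^+ 2)%:E =
    (itg (- delta) delta (fun y => phi (x, y) ^+ 2))%:E)%E.
  rewrite -itg_EFin; last exact: continuous_sqr.
  rewrite [RHS]integral_mkcond; apply: eq_integral => y _; rewrite patchE.
  case: ifPn => //; rewrite notin_setE/= in_itv/= -ler_norml => /negP; rewrite -ltNge => yd.
  by rewrite zero ?expr0n// ltW.
apply: (@le_trans _ _ (((2 * delta) ^+ 2)%:E *
    (itg (- delta) delta (fun y => partialy phi (x, y) ^+ 2))%:E)%E).
  rewrite -EFinM lee_fin.
  have -> : 2 * delta = delta - - delta by ring.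
  apply: (@itg_poincare0 _ _ _ (fun y => phi (x, y)) _ delta) => //.
  - by lra.
  - by move=> y; exact: test_slicey.
  - by apply/andP; split; lra.
  - by rewrite zero// ger0_norm// ltW.
rewrite lee_wpmul2l// ?lee_fin ?sqr_ge0// -itg_EFin; last exact: continuous_sqr.
apply: ge0_subset_integral => //.
- by apply/measurable_EFinP; apply: continuous_measurable_fun; exact: continuous_sqr.
- by move=> y _; rewrite lee_fin sqr_ge0.
Qed.

Lemma rect_estimate (a c s : R) : 0 < s ->
  (\int[leb2 R]_(z in rect a (a + s) c (c + s)) (phi z ^+ 2)%:E <=
   ((s^-1 * \int[leb2 R]_(z in rect a (a + s) c (c + s)) (phi z)) ^+ 2)%R%:E +
   (s ^+ 2)%:E * (\int[leb2 R]_(z in rect a (a + s) c (c + s)) (partialx phi z ^+ 2)%:E +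
                  \int[leb2 R]_(z in rect a (a + s) c (c + s)) (partialy phi z ^+ 2)%:E))%E.
Proof.
move=> s0; have [bphi bx by_] := test_bounded_continuous.
have sq F : bounded_continuous F -> bounded_continuous (fun z => F z ^+ 2).
  exact: bounded_continuous_sqr.
rewrite !rect_integral_yx; [|exact: sq|exact: sq|exact: sq].
rewrite /Rintegral rect_integral_yx//= -EFinD lee_fin exprMn.
exact: (square_poincare a c s0 bphi bx by_ test_slicex test_slicey).
Qed.

End TestFunctionEstimates.

Lemma grid_unique (R : realType) (s t : R) (i j : nat) : 0 < s ->
  i%:R * s <= t < i%:R * s + s -> j%:R * s <= t < j%:R * s + s -> i = j.
Proof.
move=> s0 /andP[i1 i2] /andP[j1 j2].
have lt k l : k%:R * s <= t -> t < l%:R * s + s -> (k <= l)%N.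
  move=> kt tl; rewrite -ltnS -(ltr_nat R) -(ltr_pM2r s0) (le_lt_trans kt)//.
  by rewrite -natr1 mulrDl mul1r.
by apply/eqP; rewrite eqn_leq !lt.
Qed.

Lemma grid_exists (R : realType) (s t : R) (N : nat) : 0 < s -> 0 <= t < N%:R * s ->
  exists i : 'I_N, i%:R * s <= t < i%:R * s + s.
Proof.
move=> s0 /andP[t0 tN]; have ts0 : 0 <= t / s by rewrite divr_ge0// ltW.
have /andP[h1 h2] := truncn_itv ts0.
have iN : (Num.truncn (t / s) < N)%N.
  by rewrite -(ltr_nat R) (le_lt_trans h1)// ltr_pdivrMr.
exists (Ordinal iN); rewrite /= -ler_pdivlMr// h1 /=.
by move: h2; rewrite ltr_pdivrMr// -natr1 mulrDl mul1r.
Qed.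

Lemma nat_mul_ge (R : realType) (s t : R) : 0 < s -> exists N : nat, t <= N%:R * s.
Proof.
move=> s0; exists (Num.truncn `|t / s|).+1.
rewrite -ler_pdivrMr// (le_trans (ler_norm _))//.
by have /andP[_ /ltW] := truncn_itv (normr_ge0 (t / s)).
Qed.

Lemma shift_itv (R : realType) (c i s t : R) :
  (c + i <= t < c + i + s) = (i <= t - c < i + s).
Proof. by rewrite lerBrDl -addrA ltrBlDl. Qed.

(** [None] is the unbounded end; the other indices are the cells of a grid on the box that starts at
    abscissa 1 and height [- G]. *)
Definition horn_grid (R : realType) (G s : R) (N M : nat)
    (k : option ('I_N * 'I_M)) : set (plane R) :=
  match k with
  | None => tail (1 + N%:R * s)
  | Some (i, j) => rect (1 + i%:R * s) (1 + i%:R * s + s) (- G + j%:R * s) (- G + j%:R * s + s)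
  end.

Lemma horn_grid_cover (R : realType) (G s : R) (N M : nat) (z : plane R) : 0 < s ->
  G + G <= M%:R * s -> 1 <= z.1 -> `|z.2| < G ->
  exists k : option ('I_N * 'I_M), horn_grid G s k z.
Proof.
move=> s0 HM z1; rewrite ltr_norml => /andP[z2 z3].
have [zN|zN] := leP (1 + N%:R * s) z.1.
  by exists None; split => //=; rewrite in_itv/= zN.
have [|i hi] := @grid_exists R s (z.1 - 1) N s0.
  by rewrite subr_ge0 z1 ltrBlDl.
have [|j hj] := @grid_exists R s (z.2 - - G) M s0.
  rewrite opprK; apply/andP; split; first by rewrite -lerBlDr sub0r ltW.
  by rewrite (lt_le_trans _ HM)// ltrD2r.
by exists (Some (i, j)); split; rewrite /= in_itv/= shift_itv.
Qed.

Lemma horn_grid_disjoint (R : realType) (G s : R) (N M : nat)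
    (k l : option ('I_N * 'I_M)) (z : plane R) : 0 < s ->
  horn_grid G s k z -> horn_grid G s l z -> k = l.
Proof.
move=> s0.
have bd (i : 'I_N) (t : R) : t < 1 + i%:R * s + s -> 1 + N%:R * s <= t -> False.
  move=> h1 h2; have := le_lt_trans h2 h1; rewrite -addrA ltrD2l.
  rewrite -[X in _ + X]mul1r -mulrDl natr1 ltr_pM2r// ltr_nat.
  by rewrite ltnS leqNgt ltn_ord.
case: k l => [[i j]|] [[i' j']|] //=; rewrite /rect /tail => -[/= + +] [/= + +];
  rewrite !in_itv/= ?andbT.
- rewrite !shift_itv => hi hj hi' hj'; congr (Some (_, _)).
    by apply/val_inj; exact: (grid_unique s0 hi hi').
  by apply/val_inj; exact: (grid_unique s0 hj hj').
- by move=> /andP[_ h] _ ? _; case: (bd i _ h).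
- by move=> ? _ /andP[_ h] _; case: (bd i' _ h).
Qed.

(** * Compact embedding for quasibounded domains *)

Section Compactness.
Context (R : realType) (U : set (plane R)).
Local Notation L := (LfunType (leb2 R) (le1_2 R)).

Lemma indic_rect_L2 (k a b c e : R) :
  (fun z => k * \1_(rect a b c e) z) \in Lfun (leb2 R) 2%:E.
Proof.
have mr := measurable_rect a b c e.
have mf : measurable_fun setT (fun z : plane R => k * \1_(rect a b c e) z).
  by apply: measurable_funM => //; exact: measurable_indic.
apply: L2P => //.
have -> : (fun z : plane R => ((k * \1_(rect a b c e) z) ^+ 2)%:E) =
    (fun z => (k ^+ 2)%:E * (\1_(rect a b c e) z)%:E)%E.
  apply/funext => z; rewrite -EFinM exprMn indicE.
  by case: (z \in _); rewrite ?expr1n ?expr0n.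
rewrite ge0_integralZl//; last 2 first.
- by apply/measurable_EFinP; exact: measurable_indic.
- by rewrite lee_fin sqr_ge0.
rewrite integral_indic// setIT; apply: lte_mul_pinfty => //.
  by rewrite lee_fin sqr_ge0.
exact: rect_finite.
Qed.

Lemma L2_dot_indic (phi : plane R -> R) (k a b c e : R) : bounded_continuous phi ->
  L2_dot phi (fun z => k * \1_(rect a b c e) z) =
  k * \int[leb2 R]_(z in rect a b c e) (phi z).
Proof.
move=> bphi; rewrite -RintegralZl; [|exact: measurable_rect|exact: rect_integrable].
rewrite [RHS]Rintegral_mkcond; apply: eq_Rintegral => z _.
rewrite patchE indicE; case: ifPn => zr; last by rewrite !mulr0.
by rewrite mulr1 mulrC.
Qed.

(** On a cell of side [sqrt eps] the Poincare constant is [eps], and it is also [eps] on a tail of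
    half-width [sqrt eps / 2]. Covering bounds the mass from above by the pieces, and disjointness
    bounds the sum of the energies of the pieces by the total energy. *)
Lemma quasibounded_compact (G : R) :
  (forall z, U z -> 1 <= z.1 /\ `|z.2| < G) ->
  (forall delta, 0 < delta -> exists X, forall z, U z -> X <= z.1 -> `|z.2| < delta) ->
  compactly_embedded U.
Proof.
move=> UG Utail eps eps0; pose s := Num.sqrt eps.
have s0 : 0 < s by rewrite sqrtr_gt0.
have s2 : s ^+ 2 = eps by rewrite sqr_sqrtr// ltW.
have d0 : 0 < s / 2 by rewrite divr_gt0.
have [X HX] := Utail _ d0.
have [N HN] := nat_mul_ge (X - 1) s0.
have [M HM] := nat_mul_ge (G + G) s0.
pose D : option ('I_N * 'I_M) -> set (plane R) := @horn_grid R G s N M.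
have mD k : measurable (D k).
  by case: k => [[i j]|]; [exact: measurable_rect|exact: measurable_tail].
have [mk mkE] := L2_lift R.
(* With the weight [s^-1] the squared pairing is exactly the mean-value term of the inequality on
   the cell. The tail has no such term, whence 0. *)
pose chi (k : option ('I_N * 'I_M)) : L := match k with
  | None => 0
  | Some (i, j) => mk _ (indic_rect_L2 s^-1 (1 + i%:R * s) (1 + i%:R * s + s)
                          (- G + j%:R * s) (- G + j%:R * s + s))
  end.
exists #|{: option ('I_N * 'I_M)}|, (fun i => chi (enum_val i)) => phi tphi.
have -> : \sum_(i < #|{: option ('I_N * 'I_M)}|) L2_dot phi (chi (enum_val i)) ^+ 2 =
    \sum_k L2_dot phi (chi k) ^+ 2.
  by rewrite [RHS](big_enum_val (fun k => L2_dot phi (chi k) ^+ 2)).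
have [phi2 px2 py2] := test_function_L2 tphi.
have [bphi bpx bpy] := test_bounded_continuous tphi.
have sq (F : plane R -> R) z : (0%E <= (F z ^+ 2)%:E)%E by rewrite lee_fin sqr_ge0.
have msq (F : plane R -> R) : F \in Lfun (leb2 R) 2%:E ->
    measurable_fun setT (fun z => (F z ^+ 2)%:E : \bar R).
  by move=> F2; apply/measurable_EFinP; apply: measurable_funX; exact: L2_measurable F2.
have cover z : (phi z ^+ 2)%:E != 0%E -> exists k, D k z.
  rewrite eqe sqrf_eq0 => /(test_support tphi) Uz.
  have [z1 z2] := UG _ Uz; exact: horn_grid_cover.
have disj k l z : D k z -> D l z -> k = l by exact: horn_grid_disjoint.
have local k : (\int[leb2 R]_(z in D k) (phi z ^+ 2)%:E <=
    (L2_dot phi (chi k) ^+ 2)%:E +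
    eps%:E * (\int[leb2 R]_(z in D k) (partialx phi z ^+ 2)%:E +
              \int[leb2 R]_(z in D k) (partialy phi z ^+ 2)%:E))%E.
  case: k => [[i j]|] /=.
    rewrite mkE L2_dot_indic// -s2.
    exact: (rect_estimate tphi (1 + i%:R * s) (- G + j%:R * s) s0).
  have hT z : U z -> 1 + N%:R * s <= z.1 -> `|z.2| < s / 2.
    by move=> Uz zX; apply: HX => //; apply: le_trans zX; rewrite -lerBlDl.
  have := tail_estimate tphi d0 hT.
  have -> : 2 * (s / 2) = s by field.
  rewrite s2 => /le_trans; apply.
  rewrite (@le_trans _ _ (eps%:E * (\int[leb2 R]_(z in tail (1 + N%:R * s)) (partialx phi z ^+ 2)%:E +
              \int[leb2 R]_(z in tail (1 + N%:R * s)) (partialy phi z ^+ 2)%:E))%E)//.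
    by rewrite lee_wpmul2l ?lee_fin ?(ltW eps0)// leeDr// integral_ge0.
  by rewrite leeDr// lee_fin sqr_ge0.
have sqE (F : plane R -> R) : F \in Lfun (leb2 R) 2%:E ->
    ((L2_dot F F)%:E = \int[leb2 R]_z (F z ^+ 2)%:E)%E.
  by move=> F2; exact: (esym (L2_integral_sqr F2)).
have := sqE _ py2; have := sqE _ px2; have := sqE _ phi2.
move: (L2_dot phi phi) (L2_dot (partialx phi) _) (L2_dot (partialy phi) _) => A B C EA EB EC.
have : forall k, exists r : R, r = L2_dot phi (chi k) by move=> k; exists (L2_dot phi (chi k)).
move=> /choice[r rE].
have -> : \sum_k L2_dot phi (chi k) ^+ 2 = \sum_k r k ^+ 2 by apply: eq_bigr => k _; rewrite rE.
have {}local k : (\int[leb2 R]_(z in D k) (phi z ^+ 2)%:E <= (r k ^+ 2)%:E +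
    eps%:E * (\int[leb2 R]_(z in D k) (partialx phi z ^+ 2)%:E +
              \int[leb2 R]_(z in D k) (partialy phi z ^+ 2)%:E))%E.
  by rewrite rE; exact: local.
rewrite -lee_fin EFinD EFinM EFinD EA EB EC.
rewrite (le_trans (integral_le_cover (leb2 R) mD (msq _ phi2) (sq phi) cover))//.
rewrite (le_trans (lee_sum _ (fun k _ => local k)))//.
rewrite big_split/= -sumEFin addeC leeD2r//.
rewrite -ge0_sume_distrr; last first.
  by move=> k _; rewrite adde_ge0// integral_ge0.
rewrite lee_wpmul2l ?lee_fin ?(ltW eps0)// big_split/=.
apply: leeD.
  exact: (disjoint_le_integral (leb2 R) mD (msq _ px2) (sq _) disj).
exact: (disjoint_le_integral (leb2 R) mD (msq _ py2) (sq _) disj).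
Qed.

End Compactness.

(** * Smooth bumps *)

Section FlatFunction.
Context (R : realType).
Implicit Types (P Q : {poly R}) (x : R).

(* The class [flat P] is closed under differentiation; all its members vanish
   to infinite order at [0]. *)
Definition flat P x : R :=
  if 0 < x then P.[x^-1] * (x * expR (- (x^-1 / 5))) else 0.

(** With [t = 1 / x], the derivative of [P(t) * x * exp(- t / 5)] is [x * exp(- t / 5)] times this
    polynomial in [t]. *)
Definition dflat P : {poly R} := 'X * P + 'X^2 * (5^-1 *: P - P^`()).

Lemma flat_le0 P x : x <= 0 -> flat P x = 0.
Proof. by move=> x0; rewrite /flat ltNge x0. Qed.

Lemma horner_growth P : exists C k, 0 <= C /\ forall t, 1 <= t -> `|P.[t]| <= C * t ^+ k.
Proof.
elim/poly_ind: P => [|P c [C [k [C0 Ck]]]].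
  by exists 0, 0%N; split => // t _; rewrite horner0 normr0 mul0r.
exists (C + `|c|), k.+1; split; first by rewrite addr_ge0.
move=> t t1; rewrite hornerMXaddC (le_trans (ler_normD _ _))// mulrDl lerD//.
  rewrite normrM exprSr mulrA ler_pM//; first exact: Ck.
  by rewrite ger0_norm// (le_trans ler01).
by rewrite ler_peMr// exprn_ege1.
Qed.

Lemma flat_quotient_bound P : exists C, forall x, 0 < x <= 1 -> `|flat P x| <= C * x ^+ 2.
Proof.
have [C [k [C0 Ck]]] := horner_growth P.
pose M : R := 5 ^+ k.+1 * k.+1`!%:R; exists (C * M) => x /andP[x0 x1].
have t1 : 1 <= x^-1 by rewrite invf_ge1.
have t0 : 0 < x^-1 by rewrite invr_gt0.
rewrite /flat x0 normrM (ger0_norm (_ : 0 <= x * _)); last first.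
  by rewrite mulr_ge0 ?expR_ge0// ltW.
have eM : (x^-1) ^+ k.+1 * expR (- (x^-1 / 5)) <= M.
  rewrite expRN ler_pdivrMr ?expR_gt0//.
  have := @expR_ge1Dxn R (x^-1 / 5) k; rewrite divr_ge0 ?(ltW t0)// => /(_ isT) h.
  have M0 : 0 <= M by rewrite mulr_ge0 ?exprn_ge0.
  rewrite (le_trans _ (ler_wpM2l M0 h))// mulrDr mulr1 expr_div_n.
  have f0 : k.+1`!%:R != 0 :> R by rewrite pnatr_eq0 -lt0n fact_gt0.
  have p0 : 5 ^+ k.+1 != 0 :> R by rewrite expf_neq0.
  rewrite /M in M0 *; move: (5 ^+ k.+1 : R) (k.+1`!%:R : R) f0 p0 M0 => p f f0 p0 M0.
  have -> : p * f * (x^-1 ^+ k.+1 / p / f) = x^-1 ^+ k.+1.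
    by move: (x^-1 ^+ k.+1) => y; field; rewrite f0 p0.
  by rewrite lerDr.
rewrite (@le_trans _ _ (C * x^-1 ^+ k * (x * expR (- (x^-1 / 5)))))//.
  by rewrite ler_wpM2r ?Ck// mulr_ge0 ?expR_ge0// ltW.
have -> : C * x^-1 ^+ k * (x * expR (- (x^-1 / 5))) =
    C * (x^-1 ^+ k.+1 * expR (- (x^-1 / 5))) * x ^+ 2.
  by rewrite exprSr; field; rewrite gt_eqF.
by apply: ler_wpM2r; [exact: sqr_ge0|exact: ler_wpM2l].
Qed.

Lemma is_derive_inv x : x != 0 -> is_derive x 1 (fun y : R => y^-1) (- x^-1 ^+ 2).
Proof.
move=> x0; have /= h := @is_deriveV R id x 1 1 x0 (is_derive_id x 1).
apply: (is_derive_eq h).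
by rewrite /GRing.scale /= mulr1 exprVn.
Qed.

Lemma is_derive_flat P x : is_derive x 1 (flat P) (flat (dflat P) x).
Proof.
have [x0|x0|<-] := ltgtP 0 x.
- pose g (y : R) := P.[y^-1] * (y * expR (- (y^-1 / 5))).
  apply: (@near_eq_is_derive _ _ _ g).
    by near=> y; rewrite /flat /g ifT//; near: y; exact: lt_nbhsr.
  have xN0 : x != 0 by rewrite gt_eqF.
  have dinv := is_derive_inv xN0.
  have dP : is_derive x 1 (fun y => P.[y^-1]) (P^`().[x^-1] * - x^-1 ^+ 2).
    exact: (@is_derive1_comp R (horner P) (fun y => y^-1)).
  have dE : is_derive x 1 (fun y => expR (- (y^-1 / 5)))
      (expR (- (x^-1 / 5)) * (5^-1 * x^-1 ^+ 2)).
    apply: (@is_derive1_comp R expR (fun y => - (y^-1 / 5))).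
    have := is_deriveM (is_derive_cst (- 5^-1 : R) x 1) dinv.
    have -> : cst (- 5^-1) * (fun y : R => y^-1) = (fun y => - (y^-1 / 5)).
      by apply/funext => y /=; rewrite /GRing.mul /= mulNr mulrC.
    by move=> /is_derive_eq; apply; rewrite /GRing.scale/=; ring.
  have dX := is_derive_id x 1.
  have dM := is_deriveM dX dE.
  have := is_deriveM dP dM => /is_derive_eq; apply.
  rewrite /flat x0 /dflat /GRing.scale /= !hornerE /=.
  have -> : (id * (fun y : R => expR (- (y^-1 / 5)))) x = x * expR (- (x^-1 / 5)) by [].
  move: (P.[x^-1]) (P^`().[x^-1]) (expR _) => p p' E.
  by field.
- apply: (@near_eq_is_derive _ _ _ (cst 0)).
    by near=> y; rewrite flat_le0//; apply: ltW; near: y; exact: lt_nbhsl.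
  by rewrite flat_le0 ?ltW//; exact: is_derive_cst.
(* At 0 the slope [flat P z / z] is continuous by the quadratic bound; its value there is 0 because
   [0^-1 = 0]. *)
rewrite flat_le0//; apply/is_derive1_caratheodory.
exists (fun z => flat P z / z); split.
- move=> z; rewrite (@flat_le0 P 0)// !subr0.
  have [->|z0] := eqVneq z 0; first by rewrite mulr0 flat_le0.
  by rewrite divfK.
- have [C PC] := flat_quotient_bound P.
  have C0 : 0 <= C.
    have := le_trans (normr_ge0 _) (PC 1 _); rewrite expr1n mulr1; apply.
    by rewrite ltr01 lexx.
  have C1 : 0 < C + 1 by rewrite ltr_wpDl.
  apply/cvgrPdist_le => /= eps eps0; near=> z.
  rewrite flat_le0// mul0r sub0r normrN.
  have [z0|z0] := leP z 0; first by rewrite flat_le0// mul0r normr0 ltW.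
  have z1 : z <= 1 by apply: ltW; near: z; exact: lt_nbhsl.
  rewrite normrM normfV ler_pdivrMr ?normr_gt0 ?gt_eqF// (gtr0_norm z0).
  rewrite (le_trans (PC _ _)) ?z0//= expr2 mulrA ler_wpM2r ?(ltW z0)//.
  have : z <= eps / (C + 1).
    by apply: ltW; near: z; apply: lt_nbhsl; rewrite divr_gt0.
  by rewrite ler_pdivlMr// => h; apply: le_trans h; rewrite mulrC ler_wpM2l ?(ltW z0)// lerDl.
- by rewrite invr0 mulr0.
Unshelve. all: by end_near. Qed.

End FlatFunction.

(** * Smooth functions of one variable and their tensor products *)

Section Smooth.
Context (R : realType).
Implicit Types (f g : R -> R) (a b x : R).

Fixpoint smooth1 (k : nat) f : Prop :=
  if k is k'.+1 then
    exists2 f', (forall x : R, is_derive x 1 f (f' x)) & smooth1 k' f'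
  else continuous f.

Lemma is_derive_continuous f f' : (forall x : R, is_derive x 1 f (f' x)) -> continuous f.
Proof.
by move=> df x; apply/differentiable_continuous/derivable1_diffP; have [] := df x.
Qed.

Lemma smooth1W k f : smooth1 k.+1 f -> smooth1 k f.
Proof.
elim: k f => [|k IH] f [f' df sf]; first exact: is_derive_continuous df.
by exists f' => //; exact: IH.
Qed.

Lemma smooth1D k f g : smooth1 k f -> smooth1 k g -> smooth1 k (fun x => f x + g x).
Proof.
elim: k f g => [|k IH] f g.
  by move=> cf cg x; apply: cvgD; [exact: cf|exact: cg].
move=> [f' df sf] [g' dg sg]; exists (fun x => f' x + g' x); last exact: IH.
by move=> x; exact: is_deriveD.
Qed.

Lemma smooth1M k f g : smooth1 k f -> smooth1 k g -> smooth1 k (fun x => f x * g x).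
Proof.
elim: k f g => [|k IH] f g; first exact: continuous_mul.
move=> sf sg; have sf' := smooth1W sf; have sg' := smooth1W sg.
case: sf sg => [f' df sf] [g' dg sg]; exists (fun x => f x * g' x + g x * f' x).
  by move=> x; exact: is_deriveM.
by apply: smooth1D; exact: IH.
Qed.

Lemma smooth1_cst k a : smooth1 k (fun=> a).
Proof.
elim: k a => [|k IH] a; first exact: continuous_const.
by exists (fun=> 0); [move=> x; exact: is_derive_cst|exact: IH].
Qed.

Lemma is_derive_affine f (f' : R) a b x : is_derive (a * x + b) 1 f f' ->
  is_derive x 1 (fun x => f (a * x + b)) (f' * a).
Proof.
move=> df; apply: (@is_derive1_comp R f (fun x => a * x + b)).
have := is_deriveD (is_deriveM (is_derive_cst a x 1) (is_derive_id x 1)) (is_derive_cst b x 1).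
by move=> /is_derive_eq; apply; rewrite scaler0 addr0 addr0 /GRing.scale /= mulr1.
Qed.

Lemma smooth1_affine k f a b : smooth1 k f -> smooth1 k (fun x => f (a * x + b)).
Proof.
elim: k f => [|k IH] f.
  move=> cf x; apply: (cvg_comp (fun x => a * x + b) f); last exact: cf.
  by apply: cvgD; [apply: cvgM; [exact: cvg_cst|exact: cvg_id]|exact: cvg_cst].
move=> [f' df sf]; exists (fun x => f' (a * x + b) * a).
  by move=> x; exact: is_derive_affine.
by apply: smooth1M; [exact: IH|exact: smooth1_cst].
Qed.

Lemma smooth1_flat k P : smooth1 k (flat P : R -> R).
Proof.
elim: k P => [|k IH] P; last by exists (flat (dflat P)) => // x; exact: is_derive_flat.
by move=> x; exact: (is_derive_continuous (is_derive_flat P)).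
Qed.

Lemma slicex_derivable (phi : plane R -> R) (x y l : R) :
  is_derive x 1 (fun x => phi (x, y)) l ->
  derivable phi (x, y) (1, 0) /\ partialx phi (x, y) = l.
Proof.
have E : (fun h : R => h^-1 *: ((phi \o shift (x, y)) (h *: (1, 0)) - phi (x, y))) =
    (fun h : R => h^-1 *: (((fun x => phi (x, y)) \o shift x) (h *: 1) - phi (x, y))).
  apply/funext => h /=; congr (_ *: (phi _ - _)).
  by congr pair; rewrite /= scaler0 add0r.
by move=> [d <-]; rewrite /partialx /derivable /derive E.
Qed.

Lemma slicey_derivable (phi : plane R -> R) (x y l : R) :
  is_derive y 1 (fun y => phi (x, y)) l ->
  derivable phi (x, y) (0, 1) /\ partialy phi (x, y) = l.
Proof.
have E : (fun h : R => h^-1 *: ((phi \o shift (x, y)) (h *: (0, 1)) - phi (x, y))) =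
    (fun h : R => h^-1 *: (((fun y => phi (x, y)) \o shift y) (h *: 1) - phi (x, y))).
  apply/funext => h /=; congr (_ *: (phi _ - _)).
  by congr pair; rewrite /= scaler0 add0r.
by move=> [d <-]; rewrite /partialy /derivable /derive E.
Qed.

Definition tensor f g : plane R -> R := fun z => f z.1 * g z.2.

Lemma tensor_derivable f f' g g' : (forall x : R, is_derive x 1 f (f' x)) ->
  (forall x : R, is_derive x 1 g (g' x)) ->
  [/\ forall z, derivable (tensor f g) z (1, 0) /\ derivable (tensor f g) z (0, 1),
      partialx (tensor f g) = tensor f' g & partialy (tensor f g) = tensor f g'].
Proof.
move=> df dg.
have dx (x y : R) : is_derive x 1 (fun x => tensor f g (x, y)) (tensor f' g (x, y)).
  have := is_deriveM (df x) (is_derive_cst (g y) x 1).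
  by move=> /is_derive_eq; apply; rewrite scaler0 add0r /GRing.scale /= mulrC.
have dy (x y : R) : is_derive y 1 (fun y => tensor f g (x, y)) (tensor f g' (x, y)).
  have := is_deriveM (is_derive_cst (f x) y 1) (dg y).
  by move=> /is_derive_eq; apply; rewrite scaler0 addr0.
split=> [[x y]||].
- by split; [exact: (slicex_derivable (dx x y)).1|exact: (slicey_derivable (dy x y)).1].
- by apply/funext => -[x y]; exact: (slicex_derivable (dx x y)).2.
- by apply/funext => -[x y]; exact: (slicey_derivable (dy x y)).2.
Qed.

Lemma continuous_tensor f g : continuous f -> continuous g -> continuous (tensor f g).
Proof.
move=> cf cg z; apply: cvgM.
  by apply: (cvg_comp fst f); [exact: cvg_fst|exact: cf].
by apply: (cvg_comp snd g); [exact: cvg_snd|exact: cg].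
Qed.

Lemma classC_tensor k f g : smooth1 k f -> smooth1 k g -> classC k (tensor f g).
Proof.
elim: k f g => [|k IH] f g; first exact: continuous_tensor.
move=> sf sg; have sf' := smooth1W sf; have sg' := smooth1W sg.
case: sf sg => [f' df sf] [g' dg sg].
have [d px py] := tensor_derivable df dg; split => //.
- by apply: continuous_tensor; exact: is_derive_continuous.
- by rewrite px; exact: IH.
- by rewrite py; exact: IH.
Qed.

End Smooth.

(** * A bump on an interval and its Rayleigh quotient *)

Section Bump.
Context (R : realType).
Implicit Types (a s x : R).

Lemma flatE (P : {poly R}) x : 0 < x -> flat P x = P.[x^-1] * flat 1 x.
Proof. by move=> x0; rewrite /flat x0 hornerC mul1r. Qed.

Lemma flat1_gt0 x : 0 < x -> 0 < flat 1 x :> R.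
Proof. by move=> x0; rewrite /flat x0 hornerC mul1r mulr_gt0// expR_gt0. Qed.

Lemma dflat1 : dflat (1 : {poly R}) = 'X + 5^-1 *: 'X^2.
Proof. by rewrite /dflat -polyC1 derivC subr0 mulr1 -scalerAr mulr1. Qed.

Lemma dflat1E (p : R) : (dflat (1 : {poly R})).[p] = p + p ^+ 2 / 5.
Proof. by rewrite dflat1 !hornerE /=; field. Qed.

(** The factor [x] in [flat] leaves a single monomial: the second derivative of [x * exp(- c / x)]
    is [c ^ 2 / x ^ 3 * exp(- c / x)]. *)
Lemma ddflat1E (p : R) : (dflat (dflat (1 : {poly R}))).[p] = p ^+ 4 / 25.
Proof.
rewrite dflat1 /dflat derivD derivX derivZ derivXn /=.
by rewrite !hornerE /=; field.
Qed.

(** With [p = 1 / u], [q = 1 / v] and [u + v = 1], this is [- B'' <= 16 * B] for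
    [B = flat 1 u * flat 1 v], divided by [B]. Both sides are symmetric, hence polynomials in
    [m = p * q = p + q], and the difference is a sum of squares plus a positive constant. *)
Lemma bump_poly (p q : R) : 0 < p -> 0 < q -> p + q = p * q ->
  2 * (p + p ^+ 2 / 5) * (q + q ^+ 2 / 5) <= p ^+ 4 / 25 + q ^+ 4 / 25 + 16.
Proof.
move=> p0 q0 pq; rewrite -subr_ge0.
have -> : p ^+ 4 / 25 + q ^+ 4 / 25 + 16 - 2 * (p + p ^+ 2 / 5) * (q + q ^+ 2 / 5) =
   (((p + q) ^+ 2 - 2 * (p * q)) ^+ 2 - 2 * (p * q) ^+ 2) / 25 + 16 -
   2 * (p * q) * (1 + (p + q) / 5 + p * q / 25) by field.
rewrite pq; move: (p * q) => m.
have -> : ((m ^+ 2 - 2 * m) ^+ 2 - 2 * m ^+ 2) / 25 + 16 - 2 * m * (1 + m / 5 + m / 25) =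
   (m ^+ 2 - 2 * m - 12) ^+ 2 / 25 + (2 / 5) * (m - 49 / 10) ^+ 2 + 159 / 250 by field.
have := sqr_ge0 (m ^+ 2 - 2 * m - 12); have := sqr_ge0 (m - 49 / 10).
by move: (_ ^+ 2) (_ ^+ 2) => x y; lra.
Qed.

Lemma bump_pointwise (u v : R) : v = 1 - u ->
  2 * flat (dflat 1) u * flat (dflat 1) v * (flat 1 u * flat 1 v) <=
  (flat (dflat (dflat 1)) u * flat 1 v + flat 1 u * flat (dflat (dflat 1)) v) *
    (flat 1 u * flat 1 v) + 16 * (flat 1 u * flat 1 v) ^+ 2.
Proof.
move=> vE; have [u0|u0] := leP u 0.
  by rewrite !(flat_le0 _ u0) !(mul0r, mulr0, addr0) expr0n /= mulr0.
have [v0|v0] := leP v 0.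
  by rewrite !(flat_le0 _ v0) !(mul0r, mulr0, addr0) expr0n /= mulr0.
rewrite !(flatE (dflat _)) // !dflat1E !ddflat1E.
have A0 := flat1_gt0 u0; have B0 := flat1_gt0 v0.
have pq : u^-1 + v^-1 = u^-1 * v^-1.
  by rewrite vE in v0 *; field; rewrite !gt_eqF.
have p0 : 0 < u^-1 by rewrite invr_gt0.
have q0 : 0 < v^-1 by rewrite invr_gt0.
have := bump_poly p0 q0 pq.
move: (u^-1) (v^-1) (flat 1 u) (flat 1 v) A0 B0 => p q A B A0 B0 h.
have AB : 0 <= (A * B) ^+ 2 by exact: sqr_ge0.
have := ler_wpM2r AB h; rewrite -subr_ge0 -[X in _ -> is_true X]subr_ge0.
by move=> /le_trans; apply; rewrite le_eqVlt; apply/orP; left; apply/eqP; ring.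
Qed.

(** The arguments are [(x - a) / s] and [(a + s - x) / s], which add up to 1, in the affine form of
    [smooth1_affine] and [is_derive_affine]. *)
Definition bump a s x : R :=
  flat 1 (s^-1 * x + - (a / s)) * flat 1 (- s^-1 * x + (1 + a / s)).

Definition dbump a s x : R :=
  flat (dflat 1) (s^-1 * x + - (a / s)) * flat 1 (- s^-1 * x + (1 + a / s)) * s^-1 -
  flat 1 (s^-1 * x + - (a / s)) * flat (dflat 1) (- s^-1 * x + (1 + a / s)) * s^-1.

Definition ddbump a s x : R :=
  (flat (dflat (dflat 1)) (s^-1 * x + - (a / s)) * flat 1 (- s^-1 * x + (1 + a / s)) -
   2 * flat (dflat 1) (s^-1 * x + - (a / s)) * flat (dflat 1) (- s^-1 * x + (1 + a / s)) +
   flat 1 (s^-1 * x + - (a / s)) * flat (dflat (dflat 1)) (- s^-1 * x + (1 + a / s))) * s^-1 ^+ 2.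

Lemma smooth1_bump k a s : smooth1 k (bump a s).
Proof. by apply: smooth1M; apply: smooth1_affine; exact: smooth1_flat. Qed.

Lemma is_derive_flat_prod (P Q : {poly R}) a s x :
  is_derive x 1
    (fun x => flat P (s^-1 * x + - (a / s)) * flat Q (- s^-1 * x + (1 + a / s)))
    (flat (dflat P) (s^-1 * x + - (a / s)) * flat Q (- s^-1 * x + (1 + a / s)) * s^-1 -
     flat P (s^-1 * x + - (a / s)) * flat (dflat Q) (- s^-1 * x + (1 + a / s)) * s^-1).
Proof.
have d1 := is_derive_affine (is_derive_flat P (s^-1 * x + - (a / s))).
have d2 := is_derive_affine (is_derive_flat Q (- s^-1 * x + (1 + a / s))).
by have := is_deriveM d1 d2 => /is_derive_eq; apply; rewrite /GRing.scale /=; ring.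
Qed.

Lemma is_derive_bump a s x : is_derive x 1 (bump a s) (dbump a s x).
Proof. exact: is_derive_flat_prod. Qed.

Lemma is_derive_dbump a s x : is_derive x 1 (dbump a s) (ddbump a s x).
Proof.
have cs := is_derive_cst (s^-1 : R) x 1.
have d1 := is_deriveM (is_derive_flat_prod (dflat 1) 1 a s x) cs.
have d2 := is_deriveM (is_derive_flat_prod 1 (dflat 1) a s x) cs.
have := is_deriveB d1 d2 => /is_derive_eq; apply.
by rewrite /ddbump /GRing.scale /=; ring.
Qed.

Lemma bump_support a s x : 0 < s -> bump a s x != 0 -> a < x < a + s.
Proof.
move=> s0; rewrite /bump mulf_eq0 negb_or => /andP[h1 h2].
have {}h1 : 0 < s^-1 * x + - (a / s).
  by rewrite ltNge; apply: contraNN h1 => h; rewrite flat_le0.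
have {}h2 : 0 < - s^-1 * x + (1 + a / s).
  by rewrite ltNge; apply: contraNN h2 => h; rewrite flat_le0.
apply/andP; split.
  rewrite -subr_gt0 -(pmulr_rgt0 _ (_ : 0 < s^-1)) ?invr_gt0//.
  by move: h1; rewrite mulrBr (mulrC s^-1 a).
rewrite -subr_gt0 -(pmulr_rgt0 _ (_ : 0 < s^-1)) ?invr_gt0//.
have -> // : s^-1 * (a + s - x) = - s^-1 * x + (1 + a / s) by field; rewrite gt_eqF.
Qed.

Lemma bump_edge a s : s != 0 -> [/\ bump a s a = 0, bump a s (a + s) = 0,
  dbump a s a = 0 & dbump a s (a + s) = 0].
Proof.
move=> s0; rewrite /bump /dbump.
have -> : s^-1 * a + - (a / s) = 0 by field.
have -> : - s^-1 * (a + s) + (1 + a / s) = 0 by field.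
by rewrite !(flat_le0 _ (lexx 0)) !(mul0r, mulr0, subr0).
Qed.

Lemma continuous_bump a s : continuous (bump a s).
Proof. exact: (is_derive_continuous (is_derive_bump a s)). Qed.

Lemma continuous_dbump a s : continuous (dbump a s).
Proof. exact: (is_derive_continuous (is_derive_dbump a s)). Qed.

Lemma continuous_ddbump a s : continuous (ddbump a s).
Proof.
(* Smoothness yields some continuous second derivative; uniqueness of derivatives identifies it with
   the explicit formula. *)
have [f' df [f'' df' cf'']] := smooth1_bump 2 a s.
have uniq (f g h : R -> R) : (forall x : R, is_derive x 1 f (g x)) ->
    (forall x : R, is_derive x 1 f (h x)) -> g = h.
  by move=> fg fh; apply/funext => x; rewrite -(@derive_val _ _ _ _ _ _ _ (fg x)) -(@derive_val _ _ _ _ _ _ _ (fh x)).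
rewrite (uniq _ _ _ df (is_derive_bump a s)) in df'.
by rewrite -(uniq _ _ _ df' (is_derive_dbump a s)).
Qed.

(** Integration by parts turns the integral of [B' ^ 2] into that of [- B * B''], for which the
    pointwise bound suffices, so neither integral has to be evaluated. *)
Lemma bump_rayleigh a s : 0 < s ->
  itg a (a + s) (fun x => dbump a s x ^+ 2) <=
  16 / s ^+ 2 * itg a (a + s) (fun x => bump a s x ^+ 2).
Proof.
move=> s0; have as_ : a < a + s by rewrite ltrDl.
have cb := @continuous_bump a s; have cd := @continuous_dbump a s.
have cdd := @continuous_ddbump a s.
have [b0 b1 d0 d1] := bump_edge a (lt0r_neq0 s0).
have dbb (x : R) : is_derive x 1 (fun x => bump a s x * dbump a s x)
    (dbump a s x ^+ 2 + bump a s x * ddbump a s x).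
  have := is_deriveM (is_derive_bump a s x) (is_derive_dbump a s x).
  by move=> /is_derive_eq; apply; rewrite /GRing.scale /=; ring.
have FTC : itg a (a + s) (fun x => dbump a s x ^+ 2 + bump a s x * ddbump a s x) = 0.
  rewrite (itg_FTC as_ dbb) ?b0 ?b1 ?mul0r ?subr0//.
  by apply: (@smooth1D R 0); [exact: continuous_sqr|exact: continuous_mul].
have cbdd := continuous_mul cb cdd; have cd2 := continuous_sqr cd.
have cb2 := continuous_sqr cb.
rewrite itgD// in FTC.
have -> : itg a (a + s) (fun x => dbump a s x ^+ 2) =
    - itg a (a + s) (fun x => bump a s x * ddbump a s x) by apply/eqP; rewrite -addr_eq0 FTC.
rewrite -mulN1r -!itgZ//; apply: itg_le.
- by apply: continuous_mul => //; exact: continuous_const.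
- by apply: continuous_mul => //; exact: continuous_const.
move=> x _; have vE : - s^-1 * x + (1 + a / s) = 1 - (s^-1 * x + - (a / s)) by ring.
have h := bump_pointwise vE; rewrite /bump /ddbump.
have s2 : 0 <= s^-1 ^+ 2 by exact: sqr_ge0.
have := ler_wpM2l s2 h; rewrite -subr_ge0 -[X in _ -> is_true X]subr_ge0.
move=> /le_trans; apply; rewrite le_eqVlt; apply/orP; left; apply/eqP.
by rewrite -exprVn; ring.
Qed.

(** The positive value at the midpoint is controlled by the integral of [dbump ^ 2], hence by that
    of [bump ^ 2] through [bump_rayleigh]. *)
Lemma itg_bump_gt0 a s : 0 < s -> 0 < itg a (a + s) (fun x => bump a s x ^+ 2).
Proof.
move=> s0; have as_ : a < a + s by rewrite ltrDl.
have [b0 _ _ _] := bump_edge a (lt0r_neq0 s0).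
have bm : 0 < bump a s (a + s / 2).
  rewrite /bump; have -> : s^-1 * (a + s / 2) + - (a / s) = 1 / 2 by field; rewrite gt_eqF.
  have -> : - s^-1 * (a + s / 2) + (1 + a / s) = 1 / 2 by field; rewrite gt_eqF.
  by rewrite mulr_gt0// flat1_gt0// divr_gt0.
have s2 : 0 < s / 2 by rewrite divr_gt0.
have := @itg_osc R a (a + s) _ _ (a + s / 2) a as_ (is_derive_bump a s) (@continuous_dbump a s).
rewrite b0 subr0 lexx (ltW as_) lerDl (ltW s2) /= lerD2l => /(_ _ isT) h.
have {}h : bump a s (a + s / 2) ^+ 2 <= s * (16 / s ^+ 2 * itg a (a + s) (fun x => bump a s x ^+ 2)).
  have aE : a + s - a = s by rewrite addrC addKr.
  rewrite (le_trans (h _)) ?aE//; first by rewrite ler_pdivrMr//; lra.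
  by rewrite ler_wpM2l ?(ltW s0)//; exact: bump_rayleigh.
rewrite ltNge; apply: contraTN h => h; rewrite -ltNge.
apply: (@le_lt_trans _ _ 0); last by rewrite exprn_gt0.
by rewrite mulr_ge0_le0 ?(ltW s0)// mulr_ge0_le0// divr_ge0// sqr_ge0.
Qed.

End Bump.

(** * Bumps on squares *)

Section SquareTestFunction.
Context (R : realType).
Implicit Types (a c s x : R) (f g : R -> R).

Lemma dbump_support a s x : 0 < s -> dbump a s x != 0 -> a < x < a + s.
Proof.
move=> s0; apply: contraR; rewrite negb_and -!leNgt => /orP[xa|xa].
  have h : s^-1 * x + - (a / s) <= 0.
    by rewrite mulrC -mulrBl mulr_le0_ge0 ?subr_le0// invr_ge0 ltW.
  by rewrite /dbump !(flat_le0 _ h) !mul0r subr0.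
have h : - s^-1 * x + (1 + a / s) <= 0.
  have -> : - s^-1 * x + (1 + a / s) = (a + s - x) / s by field; rewrite gt_eqF.
  by rewrite mulr_le0_ge0 ?subr_le0// invr_ge0 ltW.
by rewrite /dbump !(flat_le0 _ h) !mulr0 !mul0r subr0.
Qed.

Lemma L2_dot_tensor f g a c s : bounded_continuous (tensor f g) ->
  continuous f -> continuous g ->
  (forall x, f x != 0 -> a < x < a + s) -> (forall x, g x != 0 -> c < x < c + s) ->
  L2_dot (tensor f g) (tensor f g) =
  itg a (a + s) (fun x => f x ^+ 2) * itg c (c + s) (fun x => g x ^+ 2).
Proof.
move=> bfg cf cg fa gc.
have cf2 := continuous_sqr cf; have cg2 := continuous_sqr cg.
have -> : L2_dot (tensor f g) (tensor f g) =
    \int[leb2 R]_(z in rect a (a + s) c (c + s)) (tensor f g z ^+ 2).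
  rewrite [RHS]Rintegral_mkcond; apply: eq_Rintegral => z _.
  rewrite patchE -expr2; case: ifPn => //; rewrite notin_setE /rect => nz.
  have [->|] := eqVneq (tensor f g z) 0; first by rewrite expr0n.
  rewrite /tensor mulf_eq0 negb_or => /andP[/fa/andP[x1 x2] /gc/andP[y1 y2]].
  by case: nz; split; rewrite /= in_itv/= ?x2 ?y2 ltW.
rewrite /Rintegral (rect_integral_yx _ _ _ _ (bounded_continuous_sqr bfg)) /=.
have -> : (fun y => itg a (a + s) (fun x => tensor f g (x, y) ^+ 2)) =
    (fun y => itg a (a + s) (fun x => f x ^+ 2) * g y ^+ 2).
  apply/funext => y; rewrite mulrC -itgZ//; congr (itg _ _ _).
  by apply/funext => x; rewrite /tensor /= exprMn mulrC.
by rewrite itgZ.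
Qed.

Definition square_bump a c s : plane R -> R := tensor (bump a s) (bump c s).

Lemma square_bump_support a c s : 0 < s ->
  closure [set z | square_bump a c s z != 0] `<=` `[a, a + s] `*` `[c, c + s].
Proof.
move=> s0; have cl : closed (`[a, a + s]%classic `*` `[c, c + s]%classic : set (plane R)).
  apply: compact_closed; first exact: norm_hausdorff.
  by apply: compact_setX; exact: segment_compact.
rewrite [X in _ `<=` X](closure_id _).1//; apply: closure_subset => z /=.
rewrite /square_bump /tensor mulf_eq0 negb_or.
move=> /andP[/(bump_support s0)/andP[x1 x2] /(bump_support s0)/andP[y1 y2]].
by split; rewrite /= in_itv/= !ltW.
Qed.

Lemma square_bump_test (U : set (plane R)) a c s : 0 < s ->
  `[a, a + s]%classic `*` `[c, c + s]%classic `<=` U ->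
  test_function U (square_bump a c s).
Proof.
move=> s0 sU; split.
- by move=> k; apply: classC_tensor; exact: smooth1_bump.
- apply: subclosed_compact (square_bump_support s0); first exact: closed_closure.
  by apply: compact_setX; exact: segment_compact.
- exact: subset_trans (square_bump_support s0) sU.
Qed.

Lemma square_bump_rayleigh a c s : 0 < s ->
  let phi := square_bump a c s in
  0 < L2_dot phi phi /\
  L2_dot (partialx phi) (partialx phi) + L2_dot (partialy phi) (partialy phi) <=
  32 / s ^+ 2 * L2_dot phi phi.
Proof.
move=> s0 phi; have tphi : test_function setT phi by exact: square_bump_test.
have [_ px py] := tensor_derivable (is_derive_bump a s) (is_derive_bump c s).
have [bphi bpx bpy] := test_bounded_continuous tphi.
rewrite /phi /square_bump px py in bphi bpx bpy *.
have cb a := @continuous_bump R a s; have cd a := @continuous_dbump R a s.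
have sb a x := @bump_support R a s x s0; have sd a x := @dbump_support a s x s0.
rewrite (L2_dot_tensor bphi (cb a) (cb c) (sb a) (sb c)).
rewrite (L2_dot_tensor bpx (cd a) (cb c) (sd a) (sb c)).
rewrite (L2_dot_tensor bpy (cb a) (cd c) (sb a) (sd c)).
have A0 := itg_bump_gt0 a s0; have C0 := itg_bump_gt0 c s0.
have := bump_rayleigh a s0; have := bump_rayleigh c s0.
move: (itg _ _ _) (itg _ _ _) (itg _ _ _) (itg _ _ _) A0 C0 => A' C' C A A0 C0 hC hA.
split; first exact: mulr_gt0.
have h1 : A' * C <= 16 / s ^+ 2 * A * C by rewrite ler_wpM2r// ltW.
have h2 : A * C' <= A * (16 / s ^+ 2 * C) by rewrite ler_wpM2l// ltW.
have -> : 32 / s ^+ 2 * (A * C) = 16 / s ^+ 2 * A * C + A * (16 / s ^+ 2 * C).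
  by move: (s ^+ 2)^-1 => r; ring.
exact: lerD.
Qed.

End SquareTestFunction.

(** * Counting squares in the horn *)

(** [sin t <= t] at [t = pi / 6]. The value [sin t = 1 / 2] comes from the triple-angle formula:
    [3 * y - 4 * y ^ 3 = 1] factors as [(y + 1) * (2 * y - 1) ^ 2 = 0]. *)
Lemma pi_ge3 (R : realType) : 3 <= pi :> R.
Proof.
pose t : R := pi / 6; have p0 : 0 < pi :> R := pi_gt0 R.
have t0 : 0 <= t by rewrite divr_ge0// ltW.
have sin_le : sin t <= t.
  have [c _ ] := @MVT_segment R sin cos 0 t t0 (fun x _ => is_derive_sin x)
    (continuous_subspaceT (@continuous_sin R)).
  by rewrite sin0 !subr0 => ->; rewrite ler_piMl// cos_le1.
have s0 : 0 <= sin t.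
  by apply: sin_ge0_pi; rewrite t0 /t ler_pdivrMr//; lra.
have eq3 : sin (pi / 2) = 3 * sin t - 4 * sin t ^+ 3.
  have cs := cos2Dsin2 t.
  have -> : pi / 2 = t + t + t by rewrite /t; field.
  rewrite sinD sinD cosD.
  have -> : cos t * cos t = 1 - sin t ^+ 2 by rewrite -cs; ring.
  have -> : (sin t * cos t + cos t * sin t) * cos t = 2 * sin t * cos t ^+ 2 by ring.
  have -> : cos t ^+ 2 = 1 - sin t ^+ 2 by rewrite -cs; ring.
  by ring.
have : (sin t + 1) * (2 * sin t - 1) ^+ 2 = 0.
  have -> : (sin t + 1) * (2 * sin t - 1) ^+ 2 = 1 - (3 * sin t - 4 * sin t ^+ 3) by ring.
  by rewrite -eq3 sin_pihalf subrr.
move=> /eqP; rewrite mulf_eq0 gt_eqF ?ltr_wpDl//= sqrf_eq0 subr_eq0 => /eqP s1.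
by move: sin_le; rewrite /t; lra.
Qed.

Lemma powR_bernoulli (R : realType) (u a : R) : 0 <= u -> a <= 0 ->
  1 + a * u <= (1 + u) `^ a.
Proof.
move=> u0 a0; have u1 : 0 < 1 + u by rewrite ltr_pwDl.
rewrite /powR gt_eqF//; apply: le_trans (expR_ge1Dx _).
by rewrite lerD2l ler_wnM2l// le_ln1Dx// (lt_le_trans _ u0)// ltrN10.
Qed.

(** Bernoulli's inequality replaces the comparison of the zeta series with an integral: summing over
    integers telescopes. *)
Lemma powR_telescope (R : realType) (d x : R) : 1 < d -> 0 < x ->
  x `^ (1 - d) - (x + 1) `^ (1 - d) <= (d - 1) * x `^ (- d).
Proof.
move=> d1 x0.
have -> : x + 1 = x * (1 + x^-1) by field; rewrite gt_eqF.
rewrite powRM ?(ltW x0) ?addr_ge0 ?invr_ge0 ?(ltW x0)//.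
have := @powR_bernoulli R x^-1 (1 - d); rewrite invr_ge0 (ltW x0) subr_le0 (ltW d1).
move=> /(_ isT isT) h.
have -> : x `^ (- d) = x `^ (1 - d) * x^-1.
  rewrite -powR_inv1 ?(ltW x0)// -powRD ?(gt_eqF x0) ?implybT//.
  by congr (_ `^ _); ring.
have := ler_wpM2l (powR_ge0 x (1 - d)) h.
by move: (x `^ (1 - d)) (_ `^ _) (x^-1) => A B C; nra.
Qed.

Lemma zeta_lower_bound (R : realType) (d : R) : 1 < d ->
  exists K : nat, 2 / (d - 1) < \sum_(k < K) (k.+1%:R / 2) `^ (- d).
Proof.
move=> d1; have d0 : 0 < d - 1 by rewrite subr_gt0.
have partial K : 1 - K.+1%:R `^ (1 - d) <= (d - 1) * \sum_(k < K) k.+1%:R `^ (- d).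
  elim: K => [|K IH]; first by rewrite big_ord0 powR1 subrr mulr0.
  rewrite big_ord_recr /= mulrDr.
  have := @powR_telescope R d K.+1%:R d1 (ltr0Sn _ _).
  rewrite natr1; move: IH; lra.
have t1 : 2 `^ (1 - d) < 1 :> R.
  rewrite /powR gt_eqF// expR_lt1 pmulr_llt0 ?ln_gt0 ?ltr1n// subr_lt0//.
(* As [2 ^ d = 2 / 2 ^ (1 - d)], the partial sum times [d - 1] has to exceed [2 ^ (1 - d)], and
   telescoping bounds it below by [1 - (K + 1) ^ (1 - d)]. The number [c] solves the equality
   case. *)
have [K HK] : exists K : nat, K.+1%:R `^ (1 - d) < 1 - 2 `^ (1 - d) :> R.
  have e0 : 0 < 1 - 2 `^ (1 - d) :> R by rewrite subr_gt0.
  pose c : R := (1 - 2 `^ (1 - d))^-1 `^ (d - 1)^-1.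
  exists (Num.truncn c); have c0 : 0 <= c by rewrite powR_ge0.
  have /andP[_ ck] := truncn_itv c0.
  have cE : c `^ (d - 1) = (1 - 2 `^ (1 - d))^-1.
    by rewrite /c -powRrM mulVf ?gt_eqF// powRr1// invr_ge0 ltW.
  rewrite -[X in _ `^ X < _]opprB powRN invf_plt ?posrE ?powR_gt0 ?ltr0n// -cE.
  by apply: gt0_ltr_powR => //; rewrite nnegrE.
exists K.
have -> : \sum_(k < K) (k.+1%:R / 2) `^ (- d) = 2 `^ d * \sum_(k < K) k.+1%:R `^ (- d) :> R.
  rewrite mulr_sumr; apply: eq_bigr => k _.
  rewrite powRM ?invr_ge0// mulrC; congr (_ * _).
  by rewrite -powR_inv1// -powRrM mulN1r opprK.
rewrite ltr_pdivrMr//.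
have h2 : 2 `^ d = 2 * (2 `^ (1 - d))^-1 :> R.
  by rewrite -powRN opprB mulr_powRB1// (lt_trans _ d1).
have A0 : 0 < 2 `^ (1 - d) :> R by rewrite powR_gt0.
rewrite h2 -!mulrA ltr_pMr// mulrC -mulrA.
rewrite mulrA ltr_pdivlMr// mul1r.
have := partial K; rewrite mulrC; move: HK; lra.
Qed.

Lemma inset_itv (R : realType) (a s x : R) : 0 < s ->
  a + s / 36 <= x <= a + s / 36 + 17 / 18 * s -> a < x < a + s.
Proof. by move=> s0 /andP[x1 x2]; apply/andP; split; lra. Qed.

(** * Geometry of the horn and packing of squares *)

Section Horn.
Variables (R : realType) (d : R) (h : R -> R).
Hypothesis hG : classG d h.

Let hpos x : 0 < x -> 0 < h x. Proof. by case: hG => -[+ _ _ _ _] _ _; exact. Qed.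

Let hlt x y : 0 < x -> x < y -> h x < h y.
Proof. by case: hG => -[_ _ + _ _] _ _; exact. Qed.

Lemma horn_inverse x : 0 < x -> 0 < hornG h x /\ h (hornG h x) = x^-1.
Proof.
move=> x0; have xV : 0 < x^-1 by rewrite invr_gt0.
case: hG => -[_ hc _ h0 hoo] _ _.
have [t t0 ht] : exists2 t, 0 < t & h t = x^-1.
  have [a /= [a0 ha]] := @filter_ex _ _ _ _ (filterI (nbhs_right_gt 0) (cvgr_lt _ h0 _ xV)).
  have [b /= [b0 hb]] :=
    @filter_ex _ _ _ _ (filterI (nbhs_pinfty_gt (num_real a)) ((cvgryPgt _).1 hoo x^-1)).
  have ab : a <= b by exact: ltW.
  have hab : Num.min (h a) (h b) <= x^-1 <= Num.max (h a) (h b).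
    by rewrite ge_min le_max (ltW ha) (ltW hb) orbT.
  have cab : {within `[a, b], continuous h}.
    apply: continuous_in_subspaceT => c; rewrite inE/= in_itv/= => /andP[ac _].
    by apply: hc; exact: lt_le_trans ac.
  have [c + hcx] := IVT ab cab hab.
  rewrite in_itv/= => /andP[ac _]; exists c => //; exact: lt_le_trans ac.
have inj : {in [set t : R | 0 < t] &, injective h}.
  move=> u v; rewrite !inE/= => u0 v0 huv; apply/eqP; rewrite eq_le !leNgt.
  apply/andP; split; apply/negP => /hlt; rewrite huv ltxx; exact/implyP.
by rewrite /hornG -ht pinvKV ?inE.
Qed.

(** Strict comparisons with the inverse function become comparisons with [1 / h]; compactness and
    the inclusion of rectangles both use [g] in this form. *)
Lemma hornG_lt x t : 0 < x -> 0 < t -> (hornG h x < t) = ((h t)^-1 < x).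
Proof.
move=> x0 t0; have [g0 hg] := horn_inverse x0.
have -> : ((h t)^-1 < x) = (h (hornG h x) < h t).
  by rewrite hg invf_plt ?posrE ?hpos.
apply/idP/idP => [|]; first exact: hlt.
rewrite !ltNge; apply: contra; rewrite le_eqVlt => /predU1P[-> //|/(hlt t0)/ltW //].
Qed.

Lemma horn_compact : compactly_embedded (horn h)°.
Proof.
apply: (@quasibounded_compact R _ (hornG h 1 + 1)).
  move=> z /interior_subset[z1 z2]; split=> //; apply: le_lt_trans z2 _.
  have [g0 hg] := horn_inverse (@ltr01 R).
  have e0 : 0 < hornG h 1 + 1 by exact: addr_gt0.
  rewrite hornG_lt ?(lt_le_trans ltr01 z1)//; apply: lt_le_trans z1.
  by rewrite -hornG_lt// ltrDl.
move=> delta d0; exists ((h delta)^-1 + 1) => z /interior_subset[z1 z2] Xz.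
apply: le_lt_trans z2 _; rewrite hornG_lt ?(lt_le_trans ltr01 z1)//.
by apply: lt_le_trans Xz; rewrite ltrDl.
Qed.

Lemma rect_horn x0 x1 t : 1 <= x0 -> 0 < t -> x1 <= (h t)^-1 ->
  `]x0, x1[%classic `*` `]- t, t[%classic `<=` (horn h)°.
Proof.
move=> x01 t0 x1t; rewrite -open_subsetE.
  move=> [x y] [] /=; rewrite !in_itv/= => /andP[x0x xx1] /andP[ty yt].
  have x1x : 1 <= x by rewrite (le_trans x01)// ltW.
  split=> //=; apply: (@le_trans _ _ t); first by rewrite ler_norml !ltW.
  rewrite leNgt hornG_lt ?(lt_le_trans ltr01 x1x)// -leNgt.
  by rewrite (le_trans _ x1t)// ltW.
have -> : `]x0, x1[%classic `*` `]- t, t[%classic =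
    fst @^-1` `]x0, x1[%classic `&` snd @^-1` `]- t, t[%classic by [].
by apply: openI; apply: open_comp (itv_open _ _) => z _; [exact: cvg_fst|exact: cvg_snd].
Qed.

(* [n k] is the number of columns that hold [k + 1] stacked squares. *)
Lemma horn_count (lambda sc : R) (K : nat) (n : 'I_K -> nat) :
  0 < sc -> 36 / sc ^+ 2 <= lambda ->
  (forall k j, (j < n k)%N -> 1 + j.+1%:R * sc <= (h (k.+1%:R * (sc / 2)))^-1) ->
  ((\sum_k n k)%:R%:E <= dirichlet_count (horn h)° lambda)%E.
Proof.
move=> sc0 lsc nh.
(* The number of squares in column [j]. Since [n] is not assumed to be monotone, the largest
   admissible level is taken. *)
pose m (j : nat) : nat := \max_(k < K | (j < n k)%N) k.+1.
have km (k : 'I_K) j : (j < n k)%N -> (k.+1 <= m j)%N.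
  by move=> jn; apply: (leq_bigmax_cond (F := fun k : 'I_K => k.+1)).
have mh (k : 'I_K) j : (j < n k)%N ->
    1 + j.+1%:R * sc <= (h ((m j)%:R * (sc / 2)))^-1.
  move=> jn; have [|k' kn mE] := @eq_bigmax_cond _ (fun k : 'I_K => (j < n k)%N) (fun k => k.+1).
    by apply/card_gt0P; exists k.
  have -> : m j = k'.+1 by rewrite -mE; apply: eq_bigl.
  exact: nh.
(* A square is indexed by its level [k] and its column [j < n k], so the squares number
   [\sum_k n k]. *)
pose T := {k : 'I_K & 'I_(n k)}.
have -> : (\sum_k n k)%N = #|{: T}|.
  rewrite card_tagged sumnE big_map big_enum /=; apply: eq_bigr => k _.
  by rewrite card_ord.
pose cx (j : nat) : R := 1 + j%:R * sc.
(* The stack in column [j] is centred on the axis: it ranges from [- m j * sc / 2] to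
   [m j * sc / 2]. *)
pose cy (k j : nat) : R := k%:R * sc - (m j)%:R * (sc / 2).
pose S (t : T) : set (plane R) :=
  `]cx (tagged t), cx (tagged t) + sc[%classic `*`
  `]cy (tag t) (tagged t), cy (tag t) (tagged t) + sc[%classic.
(* The support is a closed set inside the open cell, whence a side slightly
   smaller than [sc]; the constant is such that [32 / (17 / 18) ^ 2 <= 36]. *)
pose phi (t : T) := square_bump (cx (tagged t) + sc / 36)
  (cy (tag t) (tagged t) + sc / 36) (17 / 18 * sc).
have sb0 : 0 < 17 / 18 * sc by apply: mulr_gt0 => //; lra.
have inS (t : T) : `[cx (tagged t) + sc / 36, cx (tagged t) + sc / 36 + 17 / 18 * sc]%classic
   `*` `[cy (tag t) (tagged t) + sc / 36, cy (tag t) (tagged t) + sc / 36 + 17 / 18 * sc]%classic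
   `<=` S t.
  move=> [x y] [] /=; rewrite !in_itv/= => xab yab.
  by split; rewrite /= in_itv/=; exact: inset_itv.
have subS (t : T) : S t `<=` (horn h)°.
  case: t => k j; rewrite /S /=; have mj := km k j (ltn_ord j).
  apply: subset_trans (@rect_horn (cx j) (cx j + sc) ((m j)%:R * (sc / 2)) _ _ _).
  - apply: setSX; last by [].
    apply: subset_itv; rewrite bnd_simp /cy; last first.
      have -> : k%:R * sc - (m j)%:R * (sc / 2) + sc = k.+1%:R * sc - (m j)%:R * (sc / 2) :> R.
        by rewrite -natr1; ring.
      rewrite lerBlDl; have -> : (m j)%:R * (sc / 2) + (m j)%:R * (sc / 2) = (m j)%:R * sc :> R.
        by field.
      by rewrite ler_pM2r// ler_nat.
    by rewrite lerBrDl subrr mulr_ge0// ltW.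
  - by rewrite /cx lerDl mulr_ge0// ltW.
  - by rewrite mulr_gt0// ?divr_gt0// ltr0n (leq_trans _ mj).
  - by rewrite /cx -addrA -[X in _ + X](_ : j.+1%:R * sc = _) ?(mh k)// -natr1 mulrDl mul1r.
apply: (disjoint_trial_count (phi := phi \o enum_val) (S := S \o enum_val)) => //=.
- exact: horn_compact.
- by move=> i; apply: square_bump_test => //; apply: subset_trans (subS _); exact: inS.
- by move=> i; apply: subset_trans (square_bump_support _) (inS _).
- move=> i j [x y] Si Sj; apply: enum_val_inj.
  case: (enum_val i) (enum_val j) Si Sj => [k a] [k' b].
  rewrite /S /= !in_itv/= => -[/andP[x1 x2] /andP[y1 y2]] [/andP[x3 x4] /andP[y3 y4]].
  have ab : a = b :> nat.
    apply: (@grid_unique R sc (x - 1)) => //; rewrite /cx in x1 x2 x3 x4; lra.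
  have kk : k = k' :> nat.
    apply: (@grid_unique R sc (y + (m a)%:R * (sc / 2))) => //; rewrite /cy -?ab in y1 y2 y3 y4; lra.
  move: b ab {x1 x2 x3 x4 y1 y2 y3 y4}; rewrite -(ord_inj kk) => b /ord_inj ->//.
- by move=> i; case: (square_bump_rayleigh (cx (tagged (enum_val i)) + sc / 36)
    (cy (tag (enum_val i)) (tagged (enum_val i)) + sc / 36) sb0).
- move=> i; have [p0] := square_bump_rayleigh (cx (tagged (enum_val i)) + sc / 36)
    (cy (tag (enum_val i)) (tagged (enum_val i)) + sc / 36) sb0.
  move=> /le_trans; apply; rewrite ler_pM2r//; apply: le_trans lsc.
  rewrite ler_pdivrMr ?exprn_gt0// mulrAC ler_pdivlMr ?exprn_gt0//.
  by have := sqr_ge0 sc; rewrite exprMn; lra.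
Qed.

End Horn.

(** The subtracted term bounds the losses: for each of the [K] levels the horn starts at abscissa 1
    and rounding down discards at most one column of width [x]. It tends to 0 with [h], while the
    sum tends to a value strictly above the target. *)
Lemma horn_cells_asymptotics (R : realType) (d : R) (h : R -> R) :
  1 < d -> classG d h ->
  exists K : nat, \forall x \near 0^'+,
    2 / (d - 1) <
    \sum_(k < K) h x / h (k.+1%:R * (x / 2)) - K%:R * (1 + x) * h x.
Proof.
move=> d1 hG; have [K HK] := zeta_lower_bound d1; exists K.
case: hG => -[hpos _ _ h0 _] [hd _] _.
have x0 : x @[x --> (0:R)^'+] --> (0:R).
  by apply: cvg_at_right_filter; exact: cvg_id.
have sumE : \sum_(k < K) h x / h (k.+1%:R * (x / 2)) @[x --> 0^'+] -->
    \sum_(k < K) (k.+1%:R / 2) `^ (- d).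
  apply: cvg_big => [|k _]; first exact: add_continuous.
  have t0 : 0 < k.+1%:R / 2 :> R by rewrite divr_gt0// ltr0n.
  rewrite powRN; apply: cvg_trans (cvgV _ (hd _ t0)); last by rewrite gt_eqF// powR_gt0.
  apply: near_eq_cvg; near=> x; rewrite /= invf_div; congr (_ / h _).
  by rewrite mulrA mulrAC.
have errE : K%:R * (1 + x) * h x @[x --> 0^'+] --> (K%:R * (1 + 0) * 0 : R).
  apply: cvgM h0; apply: cvgM; first exact: cvg_cst.
  by apply: cvgD x0; exact: cvg_cst.
have /(_ _) lim := cvgB sumE errE; rewrite mulr0 subr0 in lim.
exact: (cvgr_gt _ lim _ HK).
Unshelve. all: by end_near. Qed.

Lemma horn_count_ge (R : realType) (d : R) (h : R -> R) (K : nat) (lambda x : R) :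
  classG d h -> 0 < x -> 36 / x ^+ 2 <= lambda ->
  2 / (d - 1) <
    \sum_(k < K) h x / h (k.+1%:R * (x / 2)) - K%:R * (1 + x) * h x ->
  ((2 / (d - 1) / (x * h x))%:E <= dirichlet_count (horn h)° lambda)%E.
Proof.
move=> hG x0 lx xK; have hx0 : 0 < h x by case: hG => -[+ _ _ _ _] _ _; apply.
(* The number of columns for level [k] before rounding: columns of width [x] between abscissa 1 and
   the point where the half-width is [k.+1%:R * (x / 2)]. *)
pose y (k : 'I_K) : R := ((h (k.+1%:R * (x / 2)))^-1 - 1) / x.
have nh k j : (j < Num.truncn (y k))%N ->
    1 + j.+1%:R * x <= (h (k.+1%:R * (x / 2)))^-1.
  by rewrite truncn_gt_nat -lerBrDl -ler_pdivlMr.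
apply: le_trans (horn_count hG x0 lx nh).
rewrite lee_fin natr_sum ler_pdivrMr ?mulr_gt0//.
apply: le_trans (ltW xK) _.
have -> : \sum_(k < K) h x / h (k.+1%:R * (x / 2)) - K%:R * (1 + x) * h x =
    \sum_(k < K) (y k - 1) * (x * h x).
  have -> : K%:R * (1 + x) * h x = \sum_(k < K) (1 + x) * h x.
    by rewrite sumr_const card_ord -[RHS]mulr_natl mulrA.
  rewrite -sumrB; apply: eq_bigr => k _; rewrite /y.
  by move: (_^-1) => B; field; rewrite gt_eqF.
rewrite mulr_suml; apply: ler_sum => k _; rewrite ler_pM2r ?mulr_gt0//.
by rewrite lerBlDr natr1 ltW// truncnS_gt.
Qed.

Theorem theorem6p3 (R : realType) (d : R) (h : R -> R)
    (d_gt1 : 1 < d) (hG : classG d h) :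
  exists2 r : R -> R,
    (forall eps, 0 < eps -> \forall lambda \near +oo,
       `|r lambda| <=
         eps * `|Num.sqrt lambda * hornF h (Num.sqrt lambda / (2 * pi))|)
  & (\forall lambda \near +oo,
       (((d - 1)^-1 * (Num.sqrt lambda / pi)
          * hornF h (Num.sqrt lambda / (2 * pi)) + r lambda)%:E
        <= dirichlet_count (horn h)° lambda)%E).
Proof.
have p0 : 0 < pi :> R := pi_gt0 R.
exists (fun=> 0) => [eps eps0|].
  by near=> l; rewrite normr0 mulr_ge0// ltW.
have [K [e /= e0 HK]] := horn_cells_asymptotics d_gt1 hG.
near=> lambda; rewrite addr0.
have l0 : 0 < Num.sqrt lambda by rewrite sqrtr_gt0.
pose x := (Num.sqrt lambda / (2 * pi))^-1.
have x0 : 0 < x by rewrite invr_gt0 divr_gt0// mulr_gt0.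
have -> : (d - 1)^-1 * (Num.sqrt lambda / pi) * hornF h (Num.sqrt lambda / (2 * pi)) =
    2 / (d - 1) / (x * h x).
  rewrite /hornF -/x; have -> : Num.sqrt lambda / pi = 2 / x.
    by rewrite /x invrK; move: (pi : R) p0 => p p0; field; rewrite gt_eqF.
  by rewrite invfM; ring.
apply: (horn_count_ge (K := K) hG) => //; last first.
  apply: HK => //=; rewrite sub0r normrN gtr0_norm//.
  rewrite /x invf_plt ?posrE ?divr_gt0 ?mulr_gt0// ltr_pdivlMr ?mulr_gt0//.
  have a0 : 0 <= e^-1 * (2 * pi) by rewrite mulr_ge0 ?invr_ge0 ?mulr_ge0 ?ltW.
  rewrite -[ltLHS](ger0_norm a0) -sqrtr_sqr ltr_sqrt//.
  by near: lambda; exact: nbhs_pinfty_gt (num_real _).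
have -> : 36 / x ^+ 2 = 9 / pi ^+ 2 * lambda.
  have lE : lambda = Num.sqrt lambda ^+ 2 by rewrite sqr_sqrtr.
  rewrite [in RHS]lE /x exprVn invrK.
  by move: (pi : R) p0 => p p0; field; rewrite gt_eqF.
rewrite ler_piMl// ler_pdivrMr ?exprn_gt0// mul1r.
have := pi_ge3 R; move: (pi : R) => p; clear => p3; nra.
Unshelve. all: by end_near. Qed.
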